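(* For the Weyl groups $W_{D_n}$ of type $D_n$, $$\tilde r(2,W_{D_n}) = \sum_{m=0}^n \tilde r(2,S_m)\,\tilde r(2,S_{n-m},\text{even parts}) + \tilde r(2,S_n,\text{even lengths}),$$ and for every prime $p\ne2$, $$\tilde r(p,W_{D_n}) = \tilde r(p,S_n) + \tilde r(p,S_n,\text{even lengths}).$$ In terms of generating functions, $$\widetilde{OGF}(2,D,x) = \widetilde{OGF}(2,A,x)\cdot\tfrac12\big(G(x,1)+G(x,-1)\big) + \widetilde{OGF}(2,A,x^2) = \tfrac12\widetilde{OGF}(2,A,x)^2 + \tfrac12\widetilde{OGF}(2,A,x)(1-x) + \widetilde{OGF}(2,A,x^2),$$ and for every prime $p\neq 2$, $$\widetilde{OGF}(p,D,x) = \widetilde{OGF}(p,A,x),\qquad OGF(p,D,x) = OGF(p,A,x).$$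
   Context: For a finite group $G$ and a prime $p$, $r(p,G)$ is the number of conjugacy classes of $G$ whose elements have order $p^d$ for some $d \ge 1$, and $\tilde r(p,G) = r(p,G)+1$ (so $d=0$ is also allowed). $W_{D_n}$ is the Weyl group of type $D_n$, i.e. the group of signed permutations of $n$ coordinates with an even number of sign changes. $S_n$ is the symmetric group, with $S_0$ and $S_1$ trivial; $\tilde r(p,S_n)$ equals the number of partitions of $n$ into powers of $p$ (including $p^0=1$). $\tilde r(2,S_n,\text{even parts})$ is the number of partitions of $n$ into powers of $2$ having an even number of parts. $\tilde r(p,S_n,\text{even lengths})$ is the number of partitions of $n$ into powers of $p$ all of whose parts are even: for $p=2$ this means no part equals $2^0$, and for $p\ne2$ this number is $0$ because all powers of $p$ are odd. $G(x,u)=\prod_{j\ge0}\frac{1}{1-ux^{2^j}}$. The generating functions, with $n$ ranging over $\mathbb{N}$, are $OGF(p,A,x)=\sum_{n} r(p,S_n)x^n$, $\widetilde{OGF}(p,A,x)=\sum_{n}\tilde r(p,S_n)x^n$, $OGF(p,D,x)=\sum_{n}r(p,W_{D_n})x^n$ and $\widetilde{OGF}(p,D,x)=\sum_{n}\tilde r(p,W_{D_n})x^n$.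
   Formalization: The p=2 identity for r̃(2,W_{D_n}) is stated for n≥1, and its first generating-function equality carries an extra −1 on the right, because at n=0 the group W_{D_0} is trivial (value 1) while the stated right-hand side equals 2. *)

(* Defs.v *)
From mathcomp Require Import all_boot all_order all_algebra all_fingroup.

Set Implicit Arguments.
Unset Strict Implicit.
Unset Printing Implicit Defensive.

Import GroupScope.
Import GRing.Theory.

(* #[x] = p ^ d for some d >= 1.  The bound on d is harmless for a prime p,
   since d < p ^ d. *)
Definition has_ppow_order (gT : finGroupType) (p : nat) (x : gT) : bool :=
  [exists d : 'I_#[x], (0 < d)%N && (#[x] == (p ^ d)%N)].

Definition r (gT : finGroupType) (p : nat) (G : {group gT}) : nat :=
  #|[set C in classes G | [forall x in C, has_ppow_order p x]]|.

Definition rt (gT : finGroupType) (p : nat) (G : {group gT}) : nat :=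
  (r p G + 1)%N.

Definition Sn (n : nat) : {group 'S_n} := [set: 'S_n]%G.

(* The signed coordinate vector +e_i is (i, false) and -e_i is (i, true).
   A signed permutation is a permutation of these 2n vectors that commutes
   with negation. *)
Definition svec (n : nat) : finType := ('I_n * bool)%type.

Definition negv n (v : svec n) : svec n := (v.1, ~~ v.2).

Definition signed_perm n (s : {perm (svec n)}) : bool :=
  [forall v, s (negv v) == negv (s v)].

Definition sign_changes n (s : {perm (svec n)}) : {set 'I_n} :=
  [set i | (s (i, false)).2].

Definition WDset (n : nat) : {set {perm (svec n)}} :=
  [set s | signed_perm s && ~~ odd #|sign_changes s|].

Lemma signed_permE n (s : {perm (svec n)}) i b :
  signed_perm s -> s (i, b) = ((s (i, false)).1, b (+) (s (i, false)).2).
Proof.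
move=> /forallP sP; case: b => /=; last by case: (s _).
by have /eqP := sP (i, false); rewrite /negv /= => ->.
Qed.

Lemma signed_permM n (s t : {perm (svec n)}) :
  signed_perm s -> signed_perm t -> signed_perm (s * t).
Proof.
move=> /forallP sP /forallP tP; apply/forallP => v.
by rewrite !permM (eqP (sP v)) (eqP (tP _)).
Qed.

Lemma odd_sign_changesM n (s t : {perm (svec n)}) :
  signed_perm s -> signed_perm t ->
  odd #|sign_changes (s * t)|
  = odd #|sign_changes s| (+) odd #|sign_changes t|.
Proof.
have oddE (u : {perm (svec n)}) : odd #|sign_changes u|
    = \big[addb/false]_(i < n) (u (i, false)).2.
  rewrite -sum1_card (big_morph odd oddD (erefl _)) big_mkcond /=.
  by apply: eq_bigr => i _; rewrite inE; case: ifP.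
move=> sP tP; rewrite !oddE.
have s1_inj : injective (fun i => (s (i, false)).1).
  move=> i j eq1; pose b := (s (i, false)).2 (+) (s (j, false)).2.
  suff /perm_inj[] : s (i, b) = s (j, false) by [].
  rewrite signed_permE // eq1 /b.
  by case: (s (j, false)) => k c /=; rewrite addbAC addbb addFb.
rewrite [X in _ = _ (+) X](reindex_inj s1_inj) -big_split /=.
apply: eq_bigr => i _; rewrite permM {1}[s (i, false)]surjective_pairing.
by rewrite (signed_permE _ _ tP).
Qed.

Lemma WD_group_set n : group_set (WDset n).
Proof.
apply/group_setP; split=> [|s t].
  rewrite inE; apply/andP; split; first by apply/forallP => v; rewrite !perm1.
  by rewrite (_ : sign_changes 1 = set0) ?cards0 //; apply/setP=> i;
    rewrite !inE perm1.
rewrite !inE => /andP[sP /negbTE s0] /andP[tP /negbTE t0].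
by rewrite signed_permM // odd_sign_changesM // s0 t0.
Qed.

Definition WD (n : nat) : {group {perm (svec n)}} := Group (WD_group_set n).

(* A partition of n is given by its multiplicities: m i is the number of parts
   equal to i.+1. *)
Definition multiplicities (n : nat) := {ffun 'I_n -> 'I_n.+1}.

Definition is_partition n (m : multiplicities n) : bool :=
  (\sum_(i < n) m i * i.+1)%N == n.

Definition parts_in n (m : multiplicities n) (P : pred nat) : bool :=
  [forall i : 'I_n, (0 < m i)%N ==> P i.+1].

Definition nparts n (m : multiplicities n) : nat := (\sum_(i < n) m i)%N.

Definition is_pow (p k : nat) : bool := [exists d : 'I_k, k == (p ^ d)%N].

Definition ppow_partitions (p n : nat) : {set multiplicities n} :=
  [set m | is_partition m && parts_in m (is_pow p)].

Definition rt_even_parts (p n : nat) : nat :=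
  #|[set m in ppow_partitions p n | ~~ odd (nparts m)]|.

(* For odd p this number is 0, as all powers of p are odd; this includes n = 0
   by convention, although the empty partition has no odd part. For p = 2 the
   empty partition is counted. *)
Definition rt_even_lengths (p n : nat) : nat :=
  if (p == 2) || (0 < n)%N
  then #|[set m in ppow_partitions p n | parts_in m (fun k => ~~ odd k)]|
  else 0.

(* A series is its sequence of coefficients; series are compared with =1. *)
Definition fps := nat -> rat.

Declare Scope fps_scope.
Delimit Scope fps_scope with fps.
Bind Scope fps_scope with fps.

Local Open Scope ring_scope.

Definition fps_const (c : rat) : fps := fun n => if n == 0%N then c else 0.
Definition fps_Xn (k : nat) : fps := fun n => (n == k)%:R.
Definition fps_add (a b : fps) : fps := fun n => a n + b n.
Definition fps_sub (a b : fps) : fps := fun n => a n - b n.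
Definition fps_scale (c : rat) (a : fps) : fps := fun n => c * a n.
Definition fps_mul (a b : fps) : fps :=
  fun n => \sum_(i < n.+1) a i * b (n - i)%N.

(* a(x^k), meaningful for k >= 1. *)
Definition fps_comp_Xn (a : fps) (k : nat) : fps :=
  fun n => if (k %| n)%N then a (n %/ k)%N else 0.

(* The coefficients 0, ..., n of 1/a, from the recurrence
   b_0 = 1/a_0,  b_n = - (1/a_0) * (a_1 b_{n-1} + ... + a_n b_0). *)
Fixpoint fps_inv_seq (a : fps) (n : nat) : seq rat :=
  if n is n'.+1 then
    let s := fps_inv_seq a n' in
    rcons s (- (a 0%N)^-1 * \sum_(i < n) a i.+1 * s`_(n' - i))
  else [:: (a 0%N)^-1].

Definition fps_inv (a : fps) : fps := fun n => (fps_inv_seq a n)`_n.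

Notation "1" := (fps_const 1%R) : fps_scope.
Notation "''X'" := (fps_Xn 1) : fps_scope.
Notation "a + b" := (fps_add a b) : fps_scope.
Notation "a - b" := (fps_sub a b) : fps_scope.
Notation "c *: a" := (fps_scale c%R a) : fps_scope.
Notation "a * b" := (fps_mul a b) : fps_scope.
Notation "a ^-1" := (fps_inv a) : fps_scope.

Lemma size_fps_inv_seq a n : size (fps_inv_seq a n) = n.+1.
Proof. by elim: n => //= n IHn; rewrite size_rcons IHn. Qed.

Lemma nth_fps_inv_seq a n k : (k <= n)%N -> (fps_inv_seq a n)`_k = fps_inv a k.
Proof.
elim: n => [|n IHn]; first by rewrite leqn0 => /eqP->.
rewrite leq_eqVlt => /orP[/eqP-> // | lt_kn].
by rewrite /= nth_rcons size_fps_inv_seq lt_kn IHn.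
Qed.

Lemma fps_mulV (a : fps) : a 0%N != 0 -> (a * a^-1)%fps =1 1%fps.
Proof.
move=> a0 [|n]; rewrite /fps_mul.
  by rewrite big_ord_recl big_ord0 addr0 /fps_inv /= mulfV.
rewrite big_ord_recl /= subn0 {1}/fps_inv /= nth_rcons size_fps_inv_seq.
rewrite ltnn eqxx mulrA mulrN mulfV // mulN1r /fps_const /=.
apply/eqP; rewrite addrC subr_eq0; apply/eqP; apply: eq_bigr => i _.
by rewrite /bump leq0n add1n subSS nth_fps_inv_seq // leq_subr.
Qed.

(* The partial product of 1/(1 - u x^(2^j)) over j < N. *)
Fixpoint Gpartial (u : rat) (N : nat) : fps :=
  if N is N'.+1 then (Gpartial u N' * (1 - u *: fps_Xn (2 ^ N'))^-1)%fps
  else 1%fps.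

(* The infinite product: as j < 2 ^ j, the factors with j > n do not affect the
   coefficient of x^n, see G_limit. *)
Definition G (u : rat) : fps := fun n => Gpartial u n.+1 n.

Lemma fps_inv_geom_low u k n : (n < k)%N ->
  ((1 - u *: fps_Xn k)^-1)%fps n = (n == 0%N)%:R.
Proof.
set a := (_ - _)%fps => lt_nk.
have a0 : a 0%N = 1.
  rewrite /a /fps_sub /fps_scale /fps_Xn /fps_const /= eq_sym.
  by rewrite (gtn_eqF (leq_ltn_trans (leq0n n) lt_nk)) mulr0 subr0.
case: n lt_nk => [|n] lt_nk; first by rewrite /fps_inv /= a0 invr1.
rewrite /fps_inv /= nth_rcons size_fps_inv_seq ltnn eqxx big1 ?mulr0 // => i _.
rewrite /a /fps_sub /fps_scale /fps_Xn /fps_const /= (ltn_eqF _) ?mulr0 ?subrr.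
  by rewrite mul0r.
exact: leq_ltn_trans (ltn_ord i) lt_nk.
Qed.

Lemma G_limit u n N : (n < N)%N -> Gpartial u N n = G u n.
Proof.
elim: N => // N IHN; rewrite ltnS leq_eqVlt => /orP[/eqP-> // | lt_nN].
have lt_n2N : (n < 2 ^ N)%N := ltn_trans lt_nN (ltn_expl N (ltnSn 1)).
rewrite -IHN //= /fps_mul big_ord_recr /= subnn.
rewrite fps_inv_geom_low ?mulr1; last exact: leq_ltn_trans (leq0n n) lt_n2N.
rewrite big1 ?add0r // => i _; rewrite fps_inv_geom_low.
  by rewrite subn_eq0 leqNgt ltn_ord mulr0.
exact: leq_ltn_trans (leq_subr i n) lt_n2N.
Qed.

Definition ogf (f : nat -> nat) : fps := fun n => (f n)%:R.

Definition OGF_A  (p : nat) : fps := ogf (fun n => r p (Sn n)).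
Definition OGFt_A (p : nat) : fps := ogf (fun n => rt p (Sn n)).
Definition OGF_D  (p : nat) : fps := ogf (fun n => r p (WD n)).
Definition OGFt_D (p : nat) : fps := ogf (fun n => rt p (WD n)).

(* Main.v *)
Require Import Defs.
From mathcomp Require Import all_boot all_order all_algebra all_fingroup.
From mathcomp Require Import cyclic pgroup ring lra.

Set Implicit Arguments.
Unset Strict Implicit.
Unset Printing Implicit Defensive.

(** In the group of all signed permutations, a conjugacy class is determined by
    a pair of partitions.  A signed permutation x permutes the coordinate axes;
    going once around a cycle of axes of length l sends +e_i back to +e_i (a
    positive cycle) or to -e_i (a negative cycle), and the class of x records
    how many cycles there are of each length and sign.  The invariant is
    complete because the vectors above a cycle of axes form a single orbit of
    the group generated by x and negation, and the stabiliser of a vector in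
    that orbit depends on the length and the sign only: matching up cycles of
    the same type gives a conjugating element ([WB_conjP]).  Every pair of
    partitions of total size n occurs ([exists_signed_cycle_type]).

    A negative cycle of length l contributes 2l to the order of x.  So x has
    p-power order iff its positive lengths l and the numbers 2l for its negative
    lengths are powers of p ([p_elt_type]); for odd p there are no negative
    cycles.  Ordinary permutations are the signed permutations without sign
    changes, so their classes are counted by the same invariant ([rt_Sn]).

    The group of type D is the subgroup of index two on which the number of sign
    changes, equivalently the number of negative cycles, is even.  Hence a class
    of the large group that meets it is either one of its classes or the union
    of two, and the latter happens iff the centraliser of x lies in the
    subgroup.  Restricting x to a negative cycle, or negation to a cycle of odd
    length, gives a centralising element with an odd number of sign changes.  If
    all cycles are positive of even length, x is conjugate to a permutation
    without sign changes, and the axes where a centralising element changes the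
    sign form a union of even cycles ([centralizer_splits]).  So the number of
    classes is the number of admissible pairs of partitions plus the number of
    partitions into even parts ([rt_WD]).

    For the series, expanding each factor of the product defining G(x,u) as a
    geometric series shows that the coefficient of x^n in G(x,u) is the sum of
    u^(number of parts) over the partitions of n into powers of 2
    ([partition_gf]).  Hence G(x,1) counts these partitions, the mean of G(x,1)
    and G(x,-1) those with an even number of parts, and doubling every part
    turns G(x,1) into G(x^2,1).  Finally G(x,-1) is the inverse of the product
    of all 1 + x^(2^j), which telescopes to 1 - x ([G_minus1]). *)

(** * Cycles of a permutation *)

Section Cycles.
Local Open Scope group_scope.
Variable U : finType.
Implicit Types (s t : {perm U}) (i : U) (S : {set U}).

Lemma perm_fixX s i k : ((s ^+ k) i == i) = (#|porbit s i| %| k)%N.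
Proof.
set l := #|_|; have l0 : (0 < l)%N by rewrite lt0n card_porbit_neq0.
have sl q : (s ^+ (q * l)) i = i.
  elim: q => [|q IHq]; first by rewrite perm1.
  by rewrite mulSn expgD permM (permX _ _ l) iter_porbit.
rewrite {1}(divn_eq k l) expgD permM sl /dvdn.
have lt_kl := ltn_pmod k l0.
apply/eqP/eqP => [fix_i | ->]; last by rewrite perm1.
have := uniq_traject_porbit s i; rewrite -/l => Ut.
apply/eqP; rewrite -(nth_uniq i _ _ Ut) ?size_traject // !nth_traject //.
by rewrite -permX fix_i.
Qed.

(** A stable set is a disjoint union of cycles. *)
Lemma dvdn_card_stable s d S :
  {in S, forall i, s i \in S} -> {in S, forall i, d %| #|porbit s i|}%N ->
  (d %| #|S|)%N.
Proof.
move=> stS dvd_d.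
have porS i : i \in S -> porbit s i \subset S.
  move=> Si; apply/subsetP=> _ /porbitP[k ->].
  by elim: k => [|k IHk]; rewrite ?perm1 // expgSr permM stS.
have /card_partition-> := preim_partitionP (porbit s) S.
apply: dvdn_sum => _ /imsetP[i Si ->].
suff -> : [set j in S | porbit s i == porbit s j] = porbit s i by apply: dvd_d.
apply/setP=> j; rewrite inE eq_porbit_mem porbit_sym.
by case: (boolP (j \in porbit s i)) => [/(subsetP (porS i Si))->|]; rewrite ?andbF.
Qed.

Lemma porbitS s i : porbit s (s i) = porbit s i.
Proof. exact: (porbit_perm s 1). Qed.

Lemma card_porbitJ s t i : #|porbit (s ^ t) (t i)| = #|porbit s i|.
Proof.
have dvdE k : (#|porbit (s ^ t) (t i)| %| k)%N = (#|porbit s i| %| k)%N.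
  by rewrite -!perm_fixX -conjXg permJ (inj_eq perm_inj).
by apply/eqP; rewrite eqn_dvd dvdE dvdnn -dvdE dvdnn.
Qed.

End Cycles.

(** * Signed permutations and their signed cycle type *)

Section SignedPermutations.
Local Open Scope group_scope.
Variable n : nat.
Implicit Types (x y g : {perm (svec n)}) (i j : 'I_n).

(** The action on the coordinate axes.  The default value of [insubd] is taken
    only when x is not a signed permutation. *)
Definition abs_perm x : 'S_n := insubd (perm_one 'I_n) [ffun i => (x (i, false)).1].

Lemma abs_permE x i b : signed_perm x -> abs_perm x i = (x (i, b)).1.
Proof.
move=> sx; rewrite (signed_permE _ _ sx) /= -pvalE val_insubd.
have x1_inj : injective (fun i => (x (i, false)).1).
  move=> j k eq1; pose c := (x (j, false)).2 (+) (x (k, false)).2.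
  suff /perm_inj[] : x (j, c) = x (k, false) by [].
  rewrite signed_permE // eq1 /c.
  by case: (x (k, false)) => u v /=; rewrite addbAC addbb addFb.
case: ifP => [_ | /negP[]]; first by rewrite ffunE.
by apply/injectiveP => j k; rewrite !ffunE; apply: x1_inj.
Qed.

Lemma signed_perm_group_set : group_set [set x : {perm svec n} | signed_perm x].
Proof.
apply/group_setP; split=> [|x y]; rewrite !inE; last exact: signed_permM.
by apply/forallP => v; rewrite !perm1.
Qed.

(** The Weyl group of type B, in which that of type D has index two. *)
Definition WB : {group {perm svec n}} := Group signed_perm_group_set.

Lemma WBP x : reflect (signed_perm x) (x \in WB).
Proof. by rewrite inE; apply: idP. Qed.

Lemma WD_WB : WD n \subset WB.
Proof. by apply/subsetP=> x; rewrite !inE => /andP[]. Qed.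

Lemma in_WD x : (x \in WD n) = (x \in WB) && ~~ odd #|sign_changes x|.
Proof. by rewrite !inE. Qed.

Lemma signed_permX x k : signed_perm x -> signed_perm (x ^+ k).
Proof. by move=> /WBP Bx; apply/WBP; rewrite groupX. Qed.

Lemma abs_permM x y :
  signed_perm x -> signed_perm y -> abs_perm (x * y) = abs_perm x * abs_perm y.
Proof.
move=> sx sy; apply/permP=> i; rewrite permM (abs_permE _ false) ?signed_permM //.
rewrite permM (abs_permE i false sx) [x (i, false)]surjective_pairing.
by rewrite -abs_permE.
Qed.

Lemma abs_perm1 : abs_perm 1 = 1.
Proof.
by apply/permP=> i; rewrite (abs_permE i false) ?perm1 //; apply/WBP/group1.
Qed.

Lemma abs_permX x k : signed_perm x -> abs_perm (x ^+ k) = abs_perm x ^+ k.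
Proof.
move=> sx; elim: k => [|k IHk]; first exact: abs_perm1.
by rewrite !expgS abs_permM ?IHk //; apply: signed_permX.
Qed.

Lemma abs_permJ x g :
  signed_perm x -> signed_perm g -> abs_perm (x ^ g) = abs_perm x ^ abs_perm g.
Proof.
move=> sx sg; apply: (mulgI (abs_perm g)).
have sxg : signed_perm (x ^ g) by apply/WBP; rewrite groupJ //; apply/WBP.
by rewrite -abs_permM // -!conjgC abs_permM.
Qed.

(** [true] when going once around the cycle of axis i reverses the vector e_i,
    that is, when this cycle is negative. *)
Definition cycle_sign x i : bool := ((x ^+ #|porbit (abs_perm x) i|) (i, false)).2.

Local Notation len x i := #|porbit (abs_perm x) i|.

Lemma signed_permXE x k i b : signed_perm x ->
  (x ^+ k) (i, b) = ((abs_perm x ^+ k) i, b (+) ((x ^+ k) (i, false)).2).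
Proof.
move=> sx; have sxk := signed_permX k sx.
by rewrite (signed_permE _ _ sxk) -abs_permX // (abs_permE _ false).
Qed.

Lemma signed_perm_cycleX x i q b : signed_perm x ->
  (x ^+ (q * len x i)) (i, b) = (i, b (+) odd q && cycle_sign x i).
Proof.
move=> sx; elim: q b => [|q IHq] b; first by rewrite perm1 addbF.
rewrite mulSn expgD permM signed_permXE // -/(cycle_sign x i).
have /eqP-> : (abs_perm x ^+ len x i) i == i by rewrite perm_fixX.
by rewrite IHq /=; case: (cycle_sign x i); case: (odd q); case: b.
Qed.

(** The length and the sign of a cycle determine the stabiliser of each vector
    above it in the group generated by x and negation. *)
Lemma signed_perm_fixX x k i b c : signed_perm x ->
  ((x ^+ k) (i, b) == (i, c)) =
  (len x i %| k)%N && (c == b (+) odd (k %/ len x i) && cycle_sign x i).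
Proof.
move=> sx; case: (boolP (_ %| k)%N) => [/dvdnP[q ->] | not_dvd] /=.
  rewrite mulnK ?lt0n ?card_porbit_neq0 // signed_perm_cycleX //.
  by rewrite xpair_eqE eqxx eq_sym.
rewrite -perm_fixX in not_dvd.
by rewrite signed_permXE // xpair_eqE (negbTE not_dvd).
Qed.

Lemma cycle_len_abs x i : len x (abs_perm x i) = len x i.
Proof. by rewrite porbitS. Qed.

Lemma cycle_sign_stable x i : signed_perm x ->
  cycle_sign x (abs_perm x i) = cycle_sign x i.
Proof.
move=> sx; rewrite /cycle_sign cycle_len_abs.
have := signed_perm_cycleX i 1 false sx; rewrite mul1n => ret.
have: (x * x ^+ len x i) (i, false) = (x ^+ len x i * x) (i, false).
  by rewrite -expgS expgSr.
(* x commutes with its power x ^+ len x i, and with negation. *)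
rewrite !permM ret /= {1}[x (i, false)]surjective_pairing -abs_permE //.
rewrite signed_permXE // [_ (_, cycle_sign _ _)]signed_permE //.
case=> _; rewrite -/(cycle_sign x i).
by case: (_.2); case: (_.2); case: (cycle_sign x i).
Qed.

Lemma cycle_len_absX x k i : len x ((abs_perm x ^+ k) i) = len x i.
Proof. by rewrite porbit_perm. Qed.

Lemma cycle_signX x k i : signed_perm x ->
  cycle_sign x ((abs_perm x ^+ k) i) = cycle_sign x i.
Proof.
move=> sx; elim: k => [|k IHk]; first by rewrite perm1.
by rewrite expgSr permM cycle_sign_stable.
Qed.

Lemma cycle_lenJ x g i : signed_perm x -> signed_perm g ->
  len (x ^ g) (abs_perm g i) = len x i.
Proof. by move=> sx sg; rewrite abs_permJ // card_porbitJ. Qed.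

Lemma cycle_signJ x g i : signed_perm x -> signed_perm g ->
  cycle_sign (x ^ g) (abs_perm g i) = cycle_sign x i.
Proof.
move=> sx sg; rewrite {1}/cycle_sign cycle_lenJ // -conjXg.
have -> : (abs_perm g i, false) = g (i, (g (i, false)).2).
  by rewrite (signed_permE _ _ sg) addbb (abs_permE _ false).
rewrite permJ.
have := signed_perm_cycleX i 1 (g (i, false)).2 sx; rewrite mul1n => -> /=.
by rewrite (signed_permE _ _ sg) /= addbAC addbb.
Qed.

Definition cycle_coords x (l : nat) (e : bool) : {set 'I_n} :=
  [set i | (len x i == l) && (cycle_sign x i == e)].

Lemma cycle_coordsJ x g l e : signed_perm x -> signed_perm g ->
  #|cycle_coords (x ^ g) l e| = #|cycle_coords x l e|.
Proof.
move=> sx sg; rewrite -(card_preimset _ (@perm_inj _ (abs_perm g))).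
by apply: eq_card => i; rewrite !inE cycle_lenJ // cycle_signJ.
Qed.

Lemma dvdn_cycle_coords x l e : signed_perm x -> (l %| #|cycle_coords x l e|)%N.
Proof.
move=> sx; apply: (@dvdn_card_stable _ (abs_perm x)) => i; rewrite !inE.
  by rewrite cycle_len_abs cycle_sign_stable.
by case/andP=> /eqP-> _.
Qed.

(** Both sides say that a certain element of the group generated by x (or y) and
    negation stabilises a vector, and these stabilisers agree. *)
Lemma signed_orbit_eq x y i j k m b c : signed_perm x -> signed_perm y ->
  len x i = len y j -> cycle_sign x i = cycle_sign y j ->
  ((x ^+ k) (i, b) == (x ^+ m) (i, c)) = ((y ^+ k) (j, b) == (y ^+ m) (j, c)).
Proof.
move=> sx sy eq_len eq_sign; wlog le_km : k m b c / (k <= m)%N.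
  move=> W; case/orP: (leq_total k m) => [/W // | /W eq_mk].
  by rewrite [LHS]eq_sym [RHS]eq_sym.
rewrite -(subnK le_km) !expgD !permM !(inj_eq perm_inj).
by rewrite [LHS]eq_sym [RHS]eq_sym !signed_perm_fixX // eq_len eq_sign.
Qed.

Lemma signed_orbit_map x y i j : signed_perm x -> signed_perm y ->
  len x i = len y j -> cycle_sign x i = cycle_sign y j ->
  exists f : svec n -> svec n, forall k b, f ((x ^+ k) (i, b)) = (y ^+ k) (j, b).
Proof.
move=> sx sy eq_len eq_sign.
exists (fun v => if [pick kb : 'I_#[x] * bool | v == (x ^+ kb.1) (i, kb.2)]
  is Some kb then (y ^+ kb.1) (j, kb.2) else v) => k b.
case: pickP => [kb /eqP eq_v | /(_ (Ordinal (ltn_pmod k (order_gt0 x)), b))] /=.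
  by apply/eqP; rewrite -(signed_orbit_eq _ _ _ _ sx sy eq_len eq_sign) eq_v.
by rewrite expg_mod_order eqxx.
Qed.

Lemma svec_in_orbit x i v : signed_perm x -> v.1 \in porbit (abs_perm x) i ->
  exists k b, v = (x ^+ k) (i, b).
Proof.
move=> sx /porbitP[k def_v]; exists k, (v.2 (+) ((x ^+ k) (i, false)).2).
by rewrite signed_permXE // -addbA addbb addbF -def_v; case: v {def_v}.
Qed.

Lemma abs_orbitX x k i b : signed_perm x ->
  ((x ^+ k) (i, b)).1 \in porbit (abs_perm x) i.
Proof. by move=> sx; rewrite signed_permXE //= mem_porbit. Qed.

(** The vectors whose axis is in A or A' stand for the subsets of [svec n] closed
    under negation.  When A is everything, f is a signed permutation conjugating
    x to y. *)
Definition partial_conjugator x y (A A' : {set 'I_n}) (f : svec n -> svec n) :=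
  [/\ forall v, v.1 \in A -> f (negv v) = negv (f v),
      forall v, v.1 \in A -> f (x v) = y (f v),
      forall v, v.1 \in A -> (f v).1 \in A'
    & forall v w, v.1 \in A -> w.1 \in A -> f v = f w -> v = w].

(** The group generated by x and negation is transitive on the vectors above a
    cycle, so sending one vector above the first cycle to one above the second
    extends equivariantly as soon as their stabilisers agree. *)
Lemma orbit_conjugator x y i j : signed_perm x -> signed_perm y ->
  len x i = len y j -> cycle_sign x i = cycle_sign y j ->
  exists f, partial_conjugator x y (porbit (abs_perm x) i) (porbit (abs_perm y) j) f.
Proof.
move=> sx sy eq_len eq_sign.
have [f fE] := signed_orbit_map sx sy eq_len eq_sign; exists f.
have negX (z : {perm svec n}) k (l : 'I_n) b : signed_perm z ->
    negv ((z ^+ k) (l, b)) = (z ^+ k) (l, ~~ b).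
  move=> sz; rewrite (signed_permXE k l b sz) (signed_permXE k l (~~ b) sz).
  by rewrite /negv /= -addNb.
have inO v : v.1 \in porbit (abs_perm x) i -> exists k b, v = (x ^+ k) (i, b).
  exact: svec_in_orbit.
split=> [v /inO[k [b ->]] | v /inO[k [b ->]] | v /inO[k [b ->]] |].
- by rewrite negX // !fE negX.
- by rewrite -!permM -expgSr !fE expgSr permM.
- by rewrite fE abs_orbitX.
move=> v w /inO[k [b ->]] /inO[m [c ->]]; rewrite !fE => /eqP eq_f.
by apply/eqP; rewrite (signed_orbit_eq _ _ _ _ sx sy eq_len eq_sign).
Qed.

Definition same_cycle_counts x y (A A' : {set 'I_n}) :=
  forall l e, #|A :&: cycle_coords x l e| = #|A' :&: cycle_coords y l e|.

Lemma orbit_cycle_coords x i l e : signed_perm x ->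
  #|porbit (abs_perm x) i :&: cycle_coords x l e| =
  if (len x i == l) && (cycle_sign x i == e) then l else 0.
Proof.
move=> sx; case: ifP => tE.
  have /andP[/eqP len_i _] := tE; rewrite -[RHS]len_i.
  apply: eq_card => j; rewrite inE andbC.
  case: porbitP => [[k ->]|]; last by rewrite andbF.
  by rewrite inE cycle_len_absX cycle_signX // tE andbT.
apply: eq_card0 => j; rewrite inE; case: porbitP => //= -[k ->].
by rewrite inE cycle_len_absX cycle_signX.
Qed.

(** By induction on the size of A: some cycle of x in A has the same type as a
    cycle of y in A', and removing both keeps the counts equal. *)
Lemma exists_partial_conjugator x y (A A' : {set 'I_n}) : signed_perm x -> signed_perm y ->
  {in A, forall i, abs_perm x i \in A} ->
  {in A', forall i, abs_perm y i \in A'} ->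
  same_cycle_counts x y A A' -> exists f, partial_conjugator x y A A' f.
Proof.
move=> sx sy.
have [N le_A] := ubnP #|A|.
elim: N => // N IHN in A A' le_A * => stA stA' eqAA'.
have [A0 | [i Ai]] := set_0Vmem A.
  by exists id; rewrite A0; split=> [v|v|v|v w]; rewrite inE.
pose l := len x i; pose e := cycle_sign x i.
have /card_gt0P[j]: (0 < #|A' :&: cycle_coords y l e|)%N.
  by rewrite -eqAA' card_gt0; apply/set0Pn; exists i; rewrite !inE Ai !eqxx.
rewrite !inE => /and3P[A'j /eqP len_j /eqP sign_j].
set O := porbit (abs_perm x) i; set O' := porbit (abs_perm y) j.
have sub z (C : {set 'I_n}) k : {in C, forall h, abs_perm z h \in C} -> k \in C ->
    porbit (abs_perm z) k \subset C.
  move=> stC Ck; apply/subsetP=> _ /porbitP[q ->].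
  by elim: q => [|q IHq]; rewrite ?perm1 // expgSr permM stC.
have sOA : O \subset A by apply: sub.
have sOA' : O' \subset A' by apply: sub.
have stD z (C : {set 'I_n}) k : {in C, forall h, abs_perm z h \in C} ->
    {in C :\: porbit (abs_perm z) k,
       forall h, abs_perm z h \in C :\: porbit (abs_perm z) k}.
  move=> stC h; rewrite !inE => /andP[notOh Ch]; rewrite stC // andbT.
  by rewrite -eq_porbit_mem porbitS eq_porbit_mem.
have [||f1 [f1N f1x f1A f1i]] := IHN (A :\: O) (A' :\: O') _ (stD _ _ _ stA)
    (stD _ _ _ stA').
- rewrite -ltnS; apply: leq_trans le_A; rewrite ltnS; apply: proper_card.
  by apply/properP; split; [exact: subsetDl | exists i; rewrite ?inE ?porbit_id].
- have cardD (C P D : {set 'I_n}) : P \subset C ->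
      #|(C :\: P) :&: D| = (#|C :&: D| - #|P :&: D|)%N.
    move=> /setIidPr sPC; rewrite -(cardsID P (C :&: D)) setIAC sPC addKn.
    by apply: eq_card => h; rewrite !inE andbA.
  by move=> l' e'; rewrite !cardD // eqAA' !orbit_cycle_coords // len_j sign_j.
have [f0 [f0N f0x f0A f0i]] := orbit_conjugator sx sy (esym len_j) (esym sign_j).
exists (fun v => if v.1 \in O then f0 v else f1 v).
have memO v : (x v).1 \in O = (v.1 \in O).
  by rewrite [v]surjective_pairing -abs_permE // -eq_porbit_mem porbitS
    eq_porbit_mem.
have inD (v : svec n) : v.1 \in A -> v.1 \in O = false -> v.1 \in A :\: O.
  by move=> Av Ov; rewrite inE Ov.
split=> [v Av|v Av|v Av|v w Av Aw] /=; rewrite ?memO; case: ifP => Ov.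
- exact: f0N.
- by rewrite f1N ?inD.
- exact: f0x.
- by rewrite f1x ?inD.
- exact: (subsetP sOA' _ (f0A _ Ov)).
- by have := f1A v (inD v Av Ov); rewrite inE => /andP[].
- case: ifP => Ow; first exact: f0i.
  move=> eq_f; have := f1A w (inD w Aw Ow).
  by rewrite -eq_f inE f0A.
case: ifP => Ow; last by apply: f1i; exact: inD.
move=> eq_f; have := f1A v (inD v Av Ov).
by rewrite eq_f inE f0A.
Qed.

Lemma WB_conj_of_counts x y : signed_perm x -> signed_perm y ->
  (forall l e, #|cycle_coords x l e| = #|cycle_coords y l e|) ->
  y \in x ^: WB.
Proof.
move=> sx sy eq_xy.
have [|||f [fN fx _ fi]] := @exists_partial_conjugator x y setT setT sx sy.
- by move=> i _; rewrite inE.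
- by move=> i _; rewrite inE.
- by move=> l e; rewrite !setTI.
have inj_f : injective f by move=> v w; apply: fi; rewrite inE.
apply/imsetP; exists (perm inj_f).
  by apply/WBP/forallP => v; rewrite !permE fN ?inE.
by apply/permP=> w; rewrite -[w](permKV (perm inj_f)) permJ !permE fx ?inE.
Qed.

(** Encodes the number of positive ([e = false]) or negative ([e = true]) cycles
    of each length as the multiplicities of a partition; the cycles of length l
    cover l times as many axes as there are cycles. *)
Definition cycle_mult x (e : bool) : multiplicities n :=
  [ffun i : 'I_n => inord (#|cycle_coords x i.+1 e| %/ i.+1)].

Lemma cycle_multE x e (i : 'I_n) : signed_perm x ->
  (cycle_mult x e i * i.+1)%N = #|cycle_coords x i.+1 e|.
Proof.
move=> sx; rewrite ffunE inordK ?divnK ?dvdn_cycle_coords // ltnS.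
apply: leq_trans (leq_div _ _) _; rewrite -[X in (_ <= X)%N](card_ord n).
exact: max_card.
Qed.

Lemma len_bounds x i : (0 < len x i <= n)%N.
Proof.
by rewrite lt0n card_porbit_neq0 -[X in (_ <= X)%N](card_ord n) max_card.
Qed.

Lemma len_index x i : exists j : 'I_n, len x i = j.+1.
Proof.
have := len_bounds x i; case: (len x i) => // l lt_ln.
by exists (Ordinal lt_ln).
Qed.

(** Equal multiplicities give equal numbers of axes for the lengths 1, ..., n,
    and no cycle has another length. *)
Lemma WB_conjP x y : signed_perm x -> signed_perm y ->
  reflect (cycle_mult x =1 cycle_mult y) (y \in x ^: WB).
Proof.
move=> sx sy; apply: (iffP idP) => [/imsetP[g /WBP sg ->] e | eq_mult].
  by apply/ffunP=> i; rewrite !ffunE cycle_coordsJ.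
apply: WB_conj_of_counts => // l e.
have empty z : (forall j : 'I_n, l != j.+1) -> #|cycle_coords z l e| = 0.
  move=> nl; apply: eq_card0 => i; rewrite inE.
  by have [j ->] := len_index z i; rewrite eq_sym (negbTE (nl j)).
case: (pickP (fun j : 'I_n => l == j.+1)) => [j /eqP-> | noj].
  by rewrite -!cycle_multE // eq_mult.
by rewrite !empty // => j; rewrite noj.
Qed.

Lemma cycle_mult_weight x : signed_perm x ->
  (\sum_(i < n) (cycle_mult x false i + cycle_mult x true i) * i.+1)%N = n.
Proof.
move=> sx; apply: etrans (card_ord n); rewrite -sum1_card.
have lt_len i : ((len x i).-1 < n)%N.
  by have /andP[l0 len] := len_bounds x i; rewrite prednK.
rewrite [RHS](partition_big (fun i => Ordinal (lt_len i)) xpredT) //=.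
apply: eq_bigr => j _; rewrite mulnDl !cycle_multE // sum1dep_card.
rewrite -(cardsID [set i | cycle_sign x i] [set i | _]) addnC.
have lenE i : (Ordinal (lt_len i) == j) = (len x i == j.+1).
  rewrite -val_eqE /=; have /andP[] := len_bounds x i.
  by case: (len x i).
by congr (_ + _)%N; apply: eq_card => i; rewrite !inE lenE;
   case: (cycle_sign x i); rewrite ?andbT ?andbF.
Qed.

Definition signed_fun (s : 'S_n) (E : {set 'I_n}) (v : svec n) : svec n :=
  (s v.1, v.2 (+) (v.1 \in E)).

Lemma signed_fun_inj s E : injective (signed_fun s E).
Proof.
by move=> [i b] [j c] [/perm_inj -> /= /(can_inj (addbK _)) ->].
Qed.

Definition mk_signed s E : {perm svec n} := perm (@signed_fun_inj s E).

Lemma mk_signedE s E i b : mk_signed s E (i, b) = (s i, b (+) (i \in E)).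
Proof. by rewrite permE. Qed.

Lemma mk_signedP s E : signed_perm (mk_signed s E).
Proof.
by apply/forallP=> -[i b]; rewrite /negv /= !mk_signedE /= addNb.
Qed.

Lemma abs_mk_signed s E : abs_perm (mk_signed s E) = s.
Proof.
by apply/permP=> i; rewrite (abs_permE _ false) ?mk_signedP // mk_signedE.
Qed.

Lemma sign_changes_mk s E : sign_changes (mk_signed s E) = E.
Proof. by apply/setP=> i; rewrite inE mk_signedE. Qed.

Lemma sign_after_X x k i : signed_perm x ->
  ((x ^+ k) (i, false)).2 =
  \big[addb/false]_(0 <= t < k) (iter t (abs_perm x) i \in sign_changes x).
Proof.
move=> sx; elim: k => [|k IHk]; first by rewrite big_geq // perm1.
rewrite big_nat_recr //= -IHk expgSr permM signed_permXE //=.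
by rewrite signed_permE //= -permX inE.
Qed.

(** Each step of the walk around the cycle of i from e_i reverses the vector iff
    the current axis is one where x changes the sign. *)
Lemma cycle_sign_odd x i : signed_perm x ->
  cycle_sign x i = odd #|porbit (abs_perm x) i :&: sign_changes x|.
Proof.
move=> sx; rewrite /cycle_sign sign_after_X //.
have -> : \big[addb/false]_(0 <= t < len x i)
      (iter t (abs_perm x) i \in sign_changes x)
    = \big[addb/false]_(j <- traject (abs_perm x) i (len x i))
        (j \in sign_changes x).
  rewrite (big_nth i) size_traject; apply: eq_big_nat => t /andP[_ lt_t].
  by rewrite nth_traject.
rewrite big_uniq ?uniq_traject_porbit //= -[in RHS]sum1_card.
rewrite (big_morph odd oddD (erefl _)).
under [RHS]eq_bigl do rewrite inE; rewrite [RHS]big_mkcondr /=.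
by apply: eq_big => [j | j _]; [rewrite -porbit_traject | case: ifP].
Qed.

End SignedPermutations.

(** * A signed permutation with prescribed cycle type *)

(** The coordinate axes are identified with the triples of a cycle type (index of
    the length, sign), the number of a cycle among those of this type, and a
    position on this cycle.  The permutation [s] advances the position
    cyclically, and [E] puts one sign change on each negative cycle. *)
Section CycleModel.
Local Open Scope group_scope.
Variable n : nat.
Variable m : bool -> multiplicities n.
Hypothesis weight_m :
  (\sum_(i < n) (m false i + m true i) * i.+1)%N = n.

Let I : finType := ('I_n * bool)%type.
Let U_ (p : I) : finType := ('I_(m p.2 p.1) * 'I_p.1.+1)%type.
Let U : finType := {p : I & U_ p}.

Let card_U : #|U| = #|'I_n|.
Proof.
rewrite card_ord -[RHS]weight_m card_tagged sumnE big_map big_enum /=.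
rewrite (eq_bigr (fun p : I => (m p.2 p.1 * p.1.+1)%N)) => [|p _]; last first.
  by rewrite card_prod !card_ord.
rewrite -(pair_bigA _ (fun (i : 'I_n) (e : bool) => (m e i * i.+1)%N)) /=.
by apply: eq_bigr => i _; rewrite big_bool addnC mulnDl.
Qed.

Let h (u : U) : 'I_n := enum_val (cast_ord card_U (enum_rank u)).
Let h' (i : 'I_n) : U := enum_val (cast_ord (esym card_U) (enum_rank i)).

Let hK : cancel h h'.
Proof. by move=> u; rewrite /h /h' enum_valK cast_ordK enum_rankK. Qed.
Let h'K : cancel h' h.
Proof. by move=> i; rewrite /h /h' enum_valK cast_ordKV enum_rankK. Qed.

Let pt p (k : 'I_(m p.2 p.1)) (j : 'I_p.1.+1) : U := @Tagged I p U_ (k, j).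
Let shift (u : U) : U := @pt (tag u) (tagged u).1 (ordS (tagged u).2).

Let shift_inj : injective shift.
Proof.
move=> [[i e] [k j]] [[i' e'] [k' j']] /= /eqP.
rewrite -tag_eqE /tag_eq /= => /andP[/eqP eq_p].
case: eq_p k' j' => <- <- k' j'; rewrite tagged_asE xpair_eqE.
by case/andP=> /eqP-> /eqP/ordS_inj->.
Qed.

Let s_fun i := h (shift (h' i)).
Let s_inj : injective s_fun.
Proof.
by move=> i j /(can_inj hK) /shift_inj /(can_inj h'K).
Qed.
Let s : 'S_n := perm s_inj.

Let sX q p k j : (s ^+ q) (h (@pt p k j)) = h (@pt p k (iter q (@ordS _) j)).
Proof.
elim: q => [|q IHq]; first by rewrite perm1.
by rewrite expgSr permM IHq permE /s_fun hK.
Qed.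

Let iter_ordS l q (j : 'I_l) : val (iter q (@ordS _) j) = ((j + q) %% l)%N.
Proof.
elim: q => [|q IHq]; first by rewrite addn0 modn_small.
by rewrite iterS /= IHq -addn1 modnDml addn1 addnS.
Qed.

Let pt_eq p k j k' j' : (@pt p k j == pt k' j') = (k == k') && (j == j').
Proof. by rewrite /pt -tag_eqE /tag_eq /= eqxx tagged_asE xpair_eqE. Qed.

Let len_s p k j : #|porbit s (h (@pt p k j))| = p.1.+1.
Proof.
have dvdE q : (#|porbit s (h (@pt p k j))| %| q)%N = (p.1.+1 %| q)%N.
  rewrite -perm_fixX sX (can_eq hK) pt_eq eqxx /= -val_eqE iter_ordS.
  by rewrite -[X in _ == X](modn_small (ltn_ord j)) -{2}[val j]addn0 eqn_modDl mod0n.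
by apply/eqP; rewrite eqn_dvd dvdE dvdnn -dvdE dvdnn.
Qed.

Let E : {set 'I_n} :=
  [set i | (tag (h' i)).2 && ((tagged (h' i)).2 == ord0)].

Let memE p k j : (h (@pt p k j) \in E) = p.2 && (j == ord0).
Proof. by rewrite inE hK. Qed.

Let card_E : #|E| = (\sum_i m true i)%N.
Proof.
have -> : (\sum_i m true i)%N = #|{: {i : 'I_n & 'I_(m true i)}}|.
  rewrite card_tagged sumnE big_map big_enum /=.
  by apply: eq_bigr => i _; rewrite card_ord.
pose f (w : {i : 'I_n & 'I_(m true i)}) :=
  h (@pt (tag w, true) (tagged w) ord0).
have f_inj : injective f.
  move=> [i k] [i' k'] /(can_inj hK) /eqP; rewrite -tag_eqE /tag_eq /=.
  case/andP=> /eqP[eq_i]; case: i' / eq_i k' => k'.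
  by rewrite tagged_asE => /eqP[->].
rewrite -(card_imset _ f_inj); apply: eq_card => i.
apply/idP/imsetP => [|[w _ ->]]; last by rewrite memE eqxx.
rewrite -[i]h'K; case: (h' i) => [[i0 e] [k j]].
rewrite -/(@pt (i0, e) k j) memE /=; case: e k j => //= k j /eqP->.
by exists (Tagged (fun i => 'I_(m true i)) k).
Qed.

Let sign_s p k j : cycle_sign (mk_signed s E) (h (@pt p k j)) = p.2.
Proof.
rewrite cycle_sign_odd ?mk_signedP // abs_mk_signed sign_changes_mk.
have EO : porbit s (h (@pt p k j)) :&: E
    = if p.2 then [set h (@pt p k ord0)] else set0.
  apply/setP=> i; rewrite inE; apply/andP/idP => [[/porbitP[q ->]] |].
    by rewrite sX memE => /andP[-> /eqP->]; rewrite inE.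
  case: p k j => i0 [] k j /=; rewrite inE => // /eqP->; rewrite memE eqxx.
  (* From position j, the cycle of length i0.+1 comes back to position 0. *)
  split=> //; apply/porbitP; exists (i0.+1 - j)%N; rewrite sX; congr (h (pt _ _)).
  apply: val_inj; rewrite iter_ordS subnKC ?modnn //.
  exact/ltnW/ltn_ord.
by rewrite EO; case: p.2; rewrite ?cards1 ?cards0.
Qed.

Let mult_s e : cycle_mult (mk_signed s E) e = m e.
Proof.
apply/ffunP=> i; apply: val_inj; apply/eqP.
rewrite -(eqn_pmul2r (ltn0Sn i)); apply/eqP.
rewrite cycle_multE ?mk_signedP // -[X in (_ * X)%N]card_ord.
rewrite -[X in (X * _)%N]card_ord -card_prod.
pose f (kj : 'I_(m e i) * 'I_i.+1) := h (@pt (i, e) kj.1 kj.2).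
have f_inj : injective f.
  by move=> [k j] [k' j'] /(can_inj hK) /eqP; rewrite pt_eq => /andP[/= /eqP-> /eqP->].
rewrite -(card_imset _ f_inj); apply: eq_card => i1; rewrite inE.
apply/idP/imsetP => [|[[k j] _ ->]]; last first.
  by rewrite sign_s abs_mk_signed len_s !eqxx.
rewrite -[i1]h'K; case: (h' i1) => [[i0 e0] [k j]].
rewrite -/(@pt (i0, e0) k j) sign_s abs_mk_signed len_s /= => /andP[].
rewrite eqSS => /eqP/val_inj eq_i /eqP eq_e.
case: i / eq_i @f f_inj => f _; case: e / eq_e @f => f.
by exists (k, j).
Qed.

(** The size of E is what relates the parity of the number of sign changes to the
    number of negative cycles. *)
Lemma exists_signed_cycle_type : exists s E,
  (forall e, cycle_mult (mk_signed s E) e = m e) /\ #|E| = (\sum_i m true i)%N.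
Proof. by exists s, E; split; [exact: mult_s | exact: card_E]. Qed.

End CycleModel.

(** * Elements of prime power order *)

Section Orders.
Local Open Scope group_scope.
Variables (n p : nat).
Implicit Types (x g : {perm svec n}) (i : 'I_n).
Local Notation len x i := #|porbit (abs_perm x) i|.

(** A cycle of length l has order l if it is positive and 2l if it is negative;
    [(cycle_sign x i).+1] is this factor 1 or 2. *)
Lemma signed_expg_eq1 x k : signed_perm x ->
  (x ^+ k == 1) = [forall i, (len x i * (cycle_sign x i).+1 %| k)%N].
Proof.
move=> sx.
have fixE i : (x ^+ k) (i, false) == (i, false)
              = (len x i * (cycle_sign x i).+1 %| k)%N.
  rewrite signed_perm_fixX //.
  case: (boolP (_ %| k)%N) => [/dvdnP[q ->] | not_dvd] /=; last first.
    by apply/esym/negP => /dvdnP[q def_k]; case/negP: not_dvd;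
      rewrite def_k mulnCA dvdn_mulr.
  have l0 : (0 < len x i)%N by rewrite lt0n card_porbit_neq0.
  rewrite mulnK // mulnC dvdn_pmul2r //.
  by case: (cycle_sign x i); rewrite ?andbT ?andbF ?dvdn2 ?dvd1n //; case: odd.
apply/eqP/forallP => [xk i | fix_all]; first by rewrite -fixE xk perm1.
apply/permP=> -[i b]; rewrite perm1.
have := fixE i; rewrite fix_all => /eqP fi.
by rewrite (signed_permE _ _ (signed_permX k sx)) fi addbF.
Qed.

Lemma signed_p_elt x : signed_perm x ->
  p.-elt x = [forall i, p.-nat (len x i * (cycle_sign x i).+1)%N].
Proof.
move=> sx; apply/idP/forallP => [px i | p_len].
  have := signed_expg_eq1 #[x] sx; rewrite expg_order eqxx => /esym/forallP dvd.
  exact: pnat_dvd (dvd i) px.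
(* Any common multiple of the cycle orders that is a power of p will do. *)
apply: (@pnat_dvd _ (\prod_i (len x i * (cycle_sign x i).+1))%N).
  rewrite order_dvdn signed_expg_eq1 //.
  by apply/forallP=> i; rewrite (bigD1 i) //= dvdn_mulr.
by apply: (big_ind (fun k => p.-nat k)) => // u v pu pv; rewrite pnatM pu.
Qed.

Lemma cycle_mult_gt0 x e i : signed_perm x ->
  (0 < cycle_mult x e i)%N =
  [exists j, (len x j == i.+1) && (cycle_sign x j == e)].
Proof.
move=> sx; rewrite -(ltn_pmul2r (ltn0Sn i)) mul0n cycle_multE // card_gt0.
by apply/set0Pn/existsP => -[j]; rewrite ?inE => jP; exists j; rewrite ?inE.
Qed.

(** Here and below, a and b describe the positive and the negative cycles; a
    negative cycle of length k has order 2k. *)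
Definition p_type (a b : multiplicities n) : bool :=
  parts_in a (fun k => p.-nat k) && parts_in b (fun k => p.-nat (k * 2)%N).

Lemma p_elt_type x : signed_perm x ->
  p.-elt x = p_type (cycle_mult x false) (cycle_mult x true).
Proof.
move=> sx; rewrite signed_p_elt //; apply/forallP/andP => [p_len | [pa pb] j].
  split; apply/forallP=> i; apply/implyP; rewrite cycle_mult_gt0 //;
    case/existsP=> j /andP[/eqP len_j /eqP sign_j];
    by have := p_len j; rewrite len_j sign_j ?muln1.
have [i len_i] := len_index x j; rewrite len_i.
case sign_j: (cycle_sign x j).
  apply: (implyP (forallP pb i)); rewrite cycle_mult_gt0 //.
  by apply/existsP; exists j; rewrite len_i sign_j !eqxx.
rewrite muln1; apply: (implyP (forallP pa i)); rewrite cycle_mult_gt0 //.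
by apply/existsP; exists j; rewrite len_i sign_j !eqxx.
Qed.

Lemma is_powE k : prime p -> (0 < k)%N -> is_pow p k = p.-nat k.
Proof.
move=> p_prime k0; apply/existsP/idP => [[d /eqP->] | /p_natP[d def_k]].
  by rewrite pnatX pnat_id.
have lt_dk : (d < k)%N by rewrite def_k ltn_expl // prime_gt1.
by exists (Ordinal lt_dk); rewrite -def_k.
Qed.

Lemma parts_in_pow (a : multiplicities n) : prime p ->
  parts_in a (fun k => p.-nat k) = parts_in a (is_pow p).
Proof. by move=> p_prime; apply: eq_forallb => i; rewrite is_powE. Qed.

End Orders.

(** * Counting classes of prime power order *)

Section ClassCount.
Local Open Scope group_scope.
Variables (gT : finGroupType) (p : nat) (G : {group gT}).

Lemma has_ppow_orderE (x : gT) : prime p -> has_ppow_order p x = p.-elt x && (x != 1).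
Proof.
move=> p_pr; rewrite -order_eq1; apply/existsP/andP => [[d /andP[d0 /eqP ox]] | ].
  rewrite /p_elt ox pnatX pnat_id //; split=> //.
  by rewrite -(expn0 p) eqn_exp2l ?prime_gt1 // -lt0n.
case=> /p_natP[d ox] ox1.
have lt_d : (d < #[x])%N by rewrite ox ltn_expl // prime_gt1.
exists (Ordinal lt_d); rewrite /= -ox eqxx andbT lt0n.
by apply: contraNneq ox1 => d0; rewrite ox d0 expn0.
Qed.

(** The summand 1 in [rt] accounts for the class of the identity. *)
Lemma rt_p_classes : prime p ->
  rt p G = #|[set C in classes G | p.-elt (repr C)]|.
Proof.
move=> p_pr; rewrite /rt /r [RHS](cardsD1 1).
have -> : 1 \in [set C in classes G | p.-elt (repr C)].
  rewrite inE -(class1G G) mem_classes // class1G.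
  by rewrite repr_group p_elt1.
rewrite addnC; congr (_ + _)%N; apply: eq_card => C; rewrite !inE.
rewrite andbCA; case: (boolP (C \in classes G)) => //= /imsetP[x Gx ->].
have [g Gg repr_x] := repr_class G x.
rewrite repr_x p_eltJ; apply/forallP/andP => [all_p | [neq1 px] y].
  have := all_p x; rewrite class_refl has_ppow_orderE //= => /andP[-> x1].
  split=> //; apply: contraNneq x1 => eq1.
  by have := class_refl G x; rewrite eq1 => /set1gP->.
apply/implyP=> /imsetP[h Gh ->]; rewrite has_ppow_orderE // p_eltJ px /=.
by apply: contraNneq neq1 => /(canRL (conjgK _)); rewrite conj1g => ->;
  rewrite class1G.
Qed.

(** Q is the condition on types that singles out the p-elements, so that only the
    number of classes of each single type remains to be found. *)
Lemma p_classes_by_type (K : finType) (type : gT -> K) (Q : pred K) :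
  {in G, forall x, p.-elt x = Q (type x)} -> prime p ->
  rt p G = (\sum_(t | Q t) #|[set C in classes G | type (repr C) == t]|)%N.
Proof.
move=> Q_type p_pr; rewrite rt_p_classes // -sum1_card.
rewrite (partition_big (fun C => type (repr C)) Q) /= => [|C]; last first.
  rewrite inE => /andP[/repr_classesP[Gx _]]; by rewrite Q_type.
apply: eq_bigr => t Qt; rewrite sum1dep_card; apply: eq_card => C; rewrite !inE.
case: (boolP (C \in classes G)) => //= /repr_classesP[Gx _].
by rewrite Q_type //; case: eqP => [-> | _]; rewrite ?Qt ?andbF.
Qed.

End ClassCount.

(** * Symmetric groups *)

Section SymmetricGroups.
Local Open Scope group_scope.
Variable n : nat.
Implicit Types (s t : 'S_n) (a b : multiplicities n).

Definition no_cycles : multiplicities n := [ffun => ord0].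

Lemma no_cyclesP b : reflect (b = no_cycles) [forall i, b i == ord0].
Proof.
apply: (iffP forallP) => [b0 | -> i]; last by rewrite ffunE.
by apply/ffunP=> i; rewrite (eqP (b0 i)) ffunE.
Qed.

Lemma parts_in_no_cycles P : parts_in no_cycles P.
Proof. by apply/forallP=> i; rewrite ffunE. Qed.

Lemma unsignedM s t : mk_signed (s * t) set0 = mk_signed s set0 * mk_signed t set0.
Proof.
by apply/permP=> -[i b]; rewrite permM !mk_signedE permM !inE !addbF.
Qed.

Lemma cycle_sign0 s i : cycle_sign (mk_signed s set0) i = false.
Proof.
by rewrite cycle_sign_odd ?mk_signedP // sign_changes_mk setI0 cards0.
Qed.

Lemma cycle_mult0 s : cycle_mult (mk_signed s set0) true = no_cycles.
Proof.
apply/ffunP=> i; apply: val_inj; rewrite [no_cycles i]ffunE /=; apply/eqP.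
rewrite -leqn0 leqNgt cycle_mult_gt0 ?mk_signedP //.
by apply/existsP => -[j]; rewrite cycle_sign0 andbF.
Qed.

Definition cycle_type s : multiplicities n := cycle_mult (mk_signed s set0) false.

(** Permutations that are conjugate as signed permutations are already conjugate
    as permutations: forget the signs of the conjugating element. *)
Lemma Sn_conjP s t : reflect (cycle_type s = cycle_type t) (t \in s ^: Sn n).
Proof.
have [sP tP] := (mk_signedP s set0, mk_signedP t set0).
apply: (iffP idP) => [/imsetP[g _ ->] | eq_st].
  have /WB_conjP : mk_signed (s ^ g) set0 \in mk_signed s set0 ^: WB n.
    suff -> : mk_signed (s ^ g) set0 = mk_signed s set0 ^ mk_signed g set0.
      by rewrite imset_f //; apply/WBP/mk_signedP.
    by apply: (mulgI (mk_signed g set0)); rewrite -unsignedM -!conjgC unsignedM.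
  by move=> /(_ sP (mk_signedP _ _)) /(_ false).
have /imsetP[g /WBP sg eq_t] : mk_signed t set0 \in mk_signed s set0 ^: WB n.
  by apply/WB_conjP => // -[]; [rewrite !cycle_mult0 | exact: eq_st].
apply/imsetP; exists (abs_perm g); first by rewrite inE.
by rewrite -[t](abs_mk_signed _ set0) eq_t abs_permJ // abs_mk_signed.
Qed.

Lemma cycle_type_partition s : is_partition (cycle_type s).
Proof.
have := cycle_mult_weight (mk_signedP s set0); rewrite cycle_mult0 => w_s.
apply/eqP; rewrite -[RHS]w_s; apply: eq_bigr => i _.
by rewrite [no_cycles i]ffunE addn0.
Qed.

Lemma exists_cycle_type a : is_partition a -> exists s, cycle_type s = a.
Proof.
move/eqP=> wa; pose m e := if e then no_cycles else a.
have [|s [E [type_s cardE]]] := @exists_signed_cycle_type n m.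
  by rewrite -[RHS]wa; apply: eq_bigr => i _; rewrite /m /= ffunE addn0.
have E0 : E = set0.
  by apply/eqP; rewrite -cards_eq0 cardE big1 // => i _; rewrite /m ffunE.
by exists s; rewrite /cycle_type -E0 type_s.
Qed.

(** Each partition of n is the cycle type of exactly one class. *)
Lemma rt_Sn p : prime p -> rt p (Sn n) = #|ppow_partitions p n|.
Proof.
move=> p_pr; pose Q a := parts_in a (is_pow p).
rewrite (@p_classes_by_type _ _ _ _ cycle_type Q) //; last first.
  move=> s _; have -> : p.-elt s = p.-elt (mk_signed s set0).
    have inj0 : injective (mk_signed (n := n) ^~ set0).
      by move=> u v /(congr1 (@abs_perm n)); rewrite !abs_mk_signed.
    pose f := Morphism (D := Sn n) (fun u v _ _ => unsignedM u v).
    have injf : 'injm f by apply/injmP => u v _ _ /inj0.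
    by rewrite /p_elt -(order_injm injf) ?inE.
  rewrite p_elt_type ?mk_signedP // /p_type cycle_mult0 parts_in_pow //.
  by rewrite parts_in_no_cycles andbT.
rewrite -sum1_card big_mkcond [RHS]big_mkcond; apply: eq_bigr => a _.
rewrite inE andbC /Q; case: ifP => //= _; case: ifP => [a_part | not_part].
  have [s type_s] := exists_cycle_type a_part.
  apply: (eq_card1 (x := s ^: Sn n)) => C; rewrite !inE.
  apply/andP/eqP => [[/repr_classesP[_ C_eq] /eqP type_C] | ->].
    by rewrite {1}C_eq; apply/class_eqP/Sn_conjP; rewrite type_s type_C.
  rewrite mem_classes ?inE //; split=> //; apply/eqP; rewrite -type_s.
  by apply/esym/Sn_conjP; have [g Gg ->] := repr_class (Sn n) s; exact: imset_f.
apply: eq_card0 => C; rewrite inE; apply/andP=> -[_ /eqP type_C].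
by have := cycle_type_partition (repr C); rewrite type_C not_part.
Qed.

End SymmetricGroups.

(** * Classes of type D *)

Section TypeD.
Local Open Scope group_scope.
Variable n : nat.
Implicit Types (x y g h : {perm (svec n)}) (a b : multiplicities n).

Lemma WD_mul g h : g \in WB n -> h \in WB n ->
  (g * h \in WD n) = ((g \in WD n) == (h \in WD n)).
Proof.
move=> Bg Bh; rewrite !in_WD groupM // Bg Bh odd_sign_changesM //; try exact/WBP.
by case: (odd _); case: (odd _).
Qed.

Lemma odd_sign_changesJ x g : x \in WB n -> g \in WB n ->
  odd #|sign_changes (x ^ g)| = odd #|sign_changes x|.
Proof.
move=> Bx Bg; have [sx sg] := (WBP _ Bx, WBP _ Bg).
have sxg : signed_perm (x ^ g) by apply/WBP; rewrite groupJ.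
have := odd_sign_changesM sg sxg; rewrite -conjgC odd_sign_changesM //.
by rewrite addbC => /addbI.
Qed.

Lemma exists_reflection : (0 < n)%N -> exists2 g, g \in WB n & g \notin WD n.
Proof.
move=> n0; exists (mk_signed 1 [set Ordinal n0]).
  exact/WBP/mk_signedP.
by rewrite in_WD sign_changes_mk cards1 andbF.
Qed.

Definition restrict_fun (O : {set 'I_n}) h (v : svec n) : svec n :=
  if v.1 \in O then h v else v.

(** Localising h to a union O of cycles of x keeps it in the centraliser of x, and
    makes the number of its sign changes computable; the interesting h are x and
    negation. *)
Lemma restrict_perm x h (O : {set 'I_n}) : signed_perm x -> signed_perm h ->
  commute x h -> {in O, forall i, abs_perm h i \in O} ->
  (forall i, (abs_perm x i \in O) = (i \in O)) ->
  exists g, [/\ signed_perm g, commute x g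
              & sign_changes g = O :&: sign_changes h].
Proof.
move=> sx sh com_xh stO memO.
have hO v : v.1 \in O -> (h v).1 \in O.
  by case: v => i b /= Oi; rewrite -abs_permE // stO.
have inj_f : injective (restrict_fun O h).
  move=> v w; rewrite /restrict_fun; case: ifP => Ov; case: ifP => Ow //.
  - exact: perm_inj.
  - by move=> eq_w; rewrite -eq_w hO in Ow.
  by move=> eq_v; rewrite eq_v hO in Ov.
exists (perm inj_f); split.
- apply/forallP=> v; rewrite !permE /restrict_fun /=.
  by case: ifP => // _; exact: (forallP sh).
- apply/permP=> -[i b]; rewrite !permM !permE /restrict_fun /=.
  rewrite -abs_permE // memO; case: ifP => // _.
  by rewrite -!permM com_xh.
apply/setP=> i; rewrite !inE permE /restrict_fun /=.
by case: (i \in O).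
Qed.

Definition splitting_type a b : bool :=
  [forall i, b i == ord0] && parts_in a (fun k => ~~ odd k).

(** This is the criterion for the class of x in the large group to split into two
    classes of the subgroup of index two. *)
Lemma centralizer_splits x : x \in WB n ->
  (forall g, g \in WB n -> commute x g -> g \in WD n) <->
  splitting_type (cycle_mult x false) (cycle_mult x true).
Proof.
move=> Bx; have sx := WBP _ Bx; split=> [cent_D | /andP[b0 even_a] g Bg com_xg].
  have odd_orbit i h : signed_perm h -> commute x h ->
      {in porbit (abs_perm x) i,
         forall j, abs_perm h j \in porbit (abs_perm x) i} ->
      ~~ odd #|porbit (abs_perm x) i :&: sign_changes h|.
    move=> sh com_xh stO.
    have [j|g [sg com_xg <-]] := restrict_perm sx sh com_xh stO.
      by rewrite -eq_porbit_mem porbitS eq_porbit_mem.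
    have Bg : g \in WB n by apply/WBP.
    by have := cent_D g Bg com_xg; rewrite in_WD Bg.
  (* On a negative cycle, x itself changes the sign an odd number of times. *)
  have no_sign i : cycle_sign x i = false.
    apply/negbTE; rewrite cycle_sign_odd //; apply: odd_orbit => // j.
    by rewrite -!eq_porbit_mem porbitS.
  (* On a cycle of odd length, so does negation. *)
  have even_len i : ~~ odd #|porbit (abs_perm x) i|.
    pose neg := mk_signed (1 : 'S_n) setT.
    have := odd_orbit i neg (mk_signedP _ _).
    rewrite sign_changes_mk setIT; apply.
      apply/permP=> -[j b]; rewrite !permM mk_signedE perm1 inE addbT.
      rewrite (signed_permE _ _ sx) [in RHS](signed_permE _ _ sx) mk_signedE.
      by rewrite perm1 inE addbT addNb.
    by move=> j; rewrite abs_mk_signed perm1.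
  apply/andP; split; apply/forallP=> i.
    rewrite -val_eqE /= -leqn0 leqNgt cycle_mult_gt0 //.
    by apply/existsP=> -[j]; rewrite no_sign andbF.
  apply/implyP; rewrite cycle_mult_gt0 // => /existsP[j /andP[/eqP <- _]].
  exact: even_len.
move/no_cyclesP in b0.
have a_part : is_partition (cycle_mult x false).
  apply/eqP; rewrite -[RHS](cycle_mult_weight sx) b0.
  by apply: eq_bigr => i _; rewrite [no_cycles n i]ffunE addn0.
have [s type_s] := exists_cycle_type a_part.
have /imsetP[h Bh eq_h] : mk_signed s set0 \in x ^: WB n.
  apply/WB_conjP; rewrite ?mk_signedP // => -[]; last by rewrite -type_s.
  by rewrite cycle_mult0 b0.
have Bgh : g ^ h \in WB n by rewrite groupJ.
have com_s : commute (mk_signed s set0) (g ^ h).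
  by rewrite eq_h /commute -!conjMg com_xg.
(* The axes whose sign is changed by an element commuting with s form a set
   stable under s, hence a union of cycles of even length. *)
rewrite in_WD Bg -(odd_sign_changesJ Bg Bh) -dvdn2.
move: (g ^ h) com_s => y com_s.
apply: (@dvdn_card_stable _ s) => i.
  have /permP/(_ (i, false)) := com_s; rewrite !permM !mk_signedE inE addbF.
  by rewrite [y (i, _)]surjective_pairing mk_signedE inE addbF !inE => ->.
move=> _; have [k len_k] := len_index (mk_signed s set0) i.
have := forallP even_a k; rewrite -type_s cycle_mult_gt0 ?mk_signedP //.
rewrite abs_mk_signed in len_k; rewrite dvdn2 len_k => /implyP; apply.
by apply/existsP; exists i; rewrite abs_mk_signed len_k cycle_sign0 !eqxx.
Qed.

Definition D_type a b : bool :=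
  ((\sum_(i < n) (a i + b i) * i.+1)%N == n) && ~~ odd (nparts b).

(** The parity is invariant under conjugation, and the model with the same cycle
    type has one sign change on each negative cycle. *)
Lemma odd_sign_changes_type x : signed_perm x ->
  odd #|sign_changes x| = odd (nparts (cycle_mult x true)).
Proof.
move=> sx; have [s [E [type_E card_E]]] :=
  @exists_signed_cycle_type n (cycle_mult x) (cycle_mult_weight sx).
have /imsetP[g Bg eq_g] : mk_signed s E \in x ^: WB n.
  by apply/WB_conjP; rewrite ?mk_signedP // => e; rewrite type_E.
have Bx : x \in WB n by apply/WBP.
by rewrite -(odd_sign_changesJ Bx Bg) -eq_g sign_changes_mk card_E.
Qed.

(** Let x be of this type, and r a reflection outside the subgroup.  Any element
    of this type is conjugate to x or to x ^ r under the subgroup, and x and x ^ r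
    are conjugate under it unless it contains the centraliser of x. *)
Lemma card_WD_classes_of_type a b : (0 < n)%N ->
  #|[set C in classes (WD n) |
     (cycle_mult (repr C) false, cycle_mult (repr C) true) == (a, b)]| =
  (D_type a b * (splitting_type a b).+1)%N.
Proof.
move=> n0; case: (boolP (D_type a b)) => [/andP[/eqP w_ab even_b] | not_D].
  pose m e := if e then b else a.
  have [s [E [type_E card_E]]] := @exists_signed_cycle_type n m w_ab.
  have [type_a type_b] := (type_E false, type_E true).
  set x := mk_signed s E in type_a type_b.
  have sx : signed_perm x by apply: mk_signedP.
  have Bx : x \in WB n by apply/WBP.
  have Dx : x \in WD n by rewrite in_WD Bx sign_changes_mk card_E.
  have inC C : C \in classes (WD n) ->
      ((cycle_mult (repr C) false, cycle_mult (repr C) true) == (a, b))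
      = (repr C \in x ^: WB n).
    move=> /repr_classesP[DC _]; have sC := WBP _ (subsetP (WD_WB n) _ DC).
    apply/eqP/WB_conjP => // [[eq_a eq_b] [] | eq_x].
    - exact: etrans type_b (esym eq_b).
    - exact: etrans type_a (esym eq_a).
    by rewrite -!eq_x type_a type_b.
  have [cent_P split_P] := centralizer_splits Bx.
  rewrite type_a type_b in cent_P split_P.
  have [r Br notDr] := exists_reflection n0.
  have Dxr : x ^ r \in WD n.
    by rewrite in_WD groupJ //= odd_sign_changesJ // sign_changes_mk card_E.
  have memS y : y \in WD n -> y \in x ^: WB n ->
      y ^: WD n \in [set C in classes (WD n) |
       (cycle_mult (repr C) false, cycle_mult (repr C) true) == (a, b)].
    move=> Dy xy; rewrite inE mem_classes //= inC ?mem_classes //.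
    have [g Dg ->] := repr_class (WD n) y.
    by case/imsetP: xy => h Bh ->; rewrite -conjgM imset_f // groupM //;
      exact: subsetP (WD_WB n) _ Dg.
  (* g either lies in the subgroup, or differs from r by an element of it. *)
  have two C : C \in [set C in classes (WD n) |
       (cycle_mult (repr C) false, cycle_mult (repr C) true) == (a, b)] ->
     C = x ^: WD n \/ C = (x ^ r) ^: WD n.
    rewrite inE => /andP[CC]; rewrite inC //; have /repr_classesP[_ C_eq] := CC.
    case/imsetP=> g Bg repr_C; case Dg: (g \in WD n).
      by left; rewrite C_eq; apply/class_eqP; rewrite repr_C imset_f.
    right; rewrite C_eq; apply/class_eqP.
    have <- : (x ^ r) ^ (r^-1 * g) = repr C by rewrite -conjgM mulKVg.
    by rewrite imset_f // WD_mul ?groupV // Dg (negbTE notDr).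
  have Sx := memS x Dx (class_refl _ _).
  have Sxr := memS (x ^ r) Dxr (imset_f _ Br).
  rewrite mul1n; case split_ab: (splitting_type a b).
    have neq_r : x ^: WD n != (x ^ r) ^: WD n.
      apply: contraFneq (negbTE notDr) => /esym/class_eqP/imsetP[d Dd eq_rd].
      have Bd := subsetP (WD_WB n) _ Dd.
      suff: r * d^-1 \in WD n by rewrite groupMr ?groupV.
      apply: (split_P split_ab); first by rewrite groupM ?groupV.
      by apply/commgP/conjg_fixP; rewrite conjgM eq_rd conjgK.
    have := cards2 (x ^: WD n) ((x ^ r) ^: WD n); rewrite neq_r => <-.
    by apply: eq_card => C; rewrite in_set2; apply/idP/orP => [/two[] -> | [] /eqP->];
      rewrite ?eqxx //; [left | right].
  have [g [Bg com_xg notDg]] : exists g, [/\ g \in WB n, commute x g & g \notin WD n].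
    case: (pickP (fun g => [&& g \in WB n, x * g == g * x & g \notin WD n])).
      by move=> g /and3P[Bg /eqP cg Dg]; exists g.
    move=> none; suff: splitting_type a b by rewrite split_ab.
    apply: cent_P => g Bg cg; apply: contraFT (none g) => Dg.
    by rewrite Bg Dg cg eqxx.
  apply: (eq_card1 (x := x ^: WD n)) => C.
  apply/idP/eqP => [/two[] // -> | -> //].
  apply/class_eqP; have <- : x ^ (g * r) = x ^ r.
    by rewrite conjgM; congr (_ ^ r); apply/conjg_fixP/commgP.
  by rewrite imset_f // WD_mul // (negbTE notDg) (negbTE notDr).
rewrite mul0n; apply: eq_card0 => C; rewrite inE; apply/andP=> -[].
move=> /repr_classesP[DC _] /eqP[eq_a eq_b]; case/negP: not_D.
have BC := subsetP (WD_WB n) _ DC; have sC := WBP _ BC.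
rewrite /D_type -{1}eq_a -eq_b cycle_mult_weight // eqxx.
by rewrite -odd_sign_changes_type //; move: DC; rewrite in_WD => /andP[].
Qed.

End TypeD.

(** * Partitions into powers of 2 and the product G(x,u) *)

Section GeneratingFunctions.
Import GRing.Theory.
Local Open Scope ring_scope.
Implicit Types (u : rat) (p q : {poly rat}) (f g : fps).

(** Identities between the coefficients up to N can be proved in the ring of
    polynomials, as products of truncations agree with products of series. *)
Lemma fps_mul_coefM f g p q N : (forall k, (k <= N)%N -> f k = p`_k) ->
  (forall k, (k <= N)%N -> g k = q`_k) ->
  forall k, (k <= N)%N -> (f * g)%fps k = (p * q)`_k.
Proof.
move=> fp gq k le_kN; rewrite coefM /fps_mul; apply: eq_bigr => i _.
rewrite fp ?gq //; first exact: leq_trans (leq_subr _ _) le_kN.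
by apply: leq_trans le_kN; rewrite -ltnS.
Qed.

Definition trunc N f : {poly rat} := \poly_(k < N.+1) f k.

Lemma truncE N f k : (k <= N)%N -> f k = (trunc N f)`_k.
Proof. by move=> le_kN; rewrite coef_poly ltnS le_kN. Qed.

Lemma fps_mulC f g : (f * g =1 g * f)%fps.
Proof.
move=> n; rewrite (fps_mul_coefM (@truncE n f) (@truncE n g)) // mulrC.
by rewrite -(fps_mul_coefM (@truncE n g) (@truncE n f)).
Qed.

Lemma fps_mul_ext f f' g g' : f =1 f' -> g =1 g' -> (f * g =1 f' * g')%fps.
Proof. by move=> ff gg n; apply: eq_bigr => i _; rewrite ff gg. Qed.

Lemma fps_mulA f g h : (f * (g * h) =1 f * g * h)%fps.
Proof.
move=> n; have [[fn gn] hn] := (@truncE n f, @truncE n g, @truncE n h).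
rewrite (fps_mul_coefM fn (fps_mul_coefM gn hn)) // mulrA.
by rewrite -(fps_mul_coefM (fps_mul_coefM fn gn) hn).
Qed.

Lemma fps_mul1 f : (f * 1 =1 f)%fps.
Proof.
move=> n; rewrite /fps_mul big_ord_recr /= subnn mulr1 big1 ?add0r // => i _.
by rewrite /fps_const subn_eq0 leqNgt ltn_ord mulr0.
Qed.

(** The geometric series of u x^k, cut after M + 1 terms: its coefficients up to M
    are the right ones for k > 0. *)
Definition geom u M k : {poly rat} := \sum_(j < M.+1) (u ^+ j) *: 'X^(j * k).

Lemma fps_inv_geom_coef u M k n : (0 < k)%N -> (n <= M)%N ->
  ((1 - u *: fps_Xn k)^-1)%fps n = (geom u M k)`_n.
Proof.
move=> k0; set f := (_ - _)%fps.
have f0 : f 0%N = 1.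
  by rewrite /f /fps_sub /fps_scale /fps_Xn /fps_const (ltn_eqF k0) mulr0 subr0.
pose p : {poly rat} := 1 - u *: 'X^k.
have fp i : (i <= M)%N -> f i = p`_i.
  by rewrite /f /fps_sub /fps_scale /fps_Xn /fps_const coefB coef1 coefZ coefXn;
    case: (i == 0%N).
(* The geometric sum telescopes, with an error term of degree above M. *)
have pg : p * geom u M k = 1 - u ^+ M.+1 *: 'X^(M.+1 * k).
  rewrite /p /geom; elim: M {fp} => [|M IHM].
    by rewrite big_ord1 expr0 mul0n mul1n scale1r mulr1 expr1.
  rewrite big_ord_recr /= mulrDr IHM mulrBl mul1r -scalerAl -scalerAr scalerA.
  by rewrite -exprD -exprS -mulSn addrA subrK.
have pgE i : (i <= M)%N -> (p * geom u M k)`_i = (i == 0%N)%:R.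
  move=> le_iM; rewrite pg coefB coef1 coefZ coefXn.
  rewrite (ltn_eqF (_ : i < M.+1 * k)%N) ?mulr0 ?subr0 //.
  by apply: leq_trans (leq_pmulr _ k0).
move=> le_nM; have fV := fps_mulV (_ : f 0%N != 0).
rewrite -(fps_mul1 (fps_inv f)) //.
pose g : fps := fun i => (geom u M k)`_i.
have fg i : (i <= M)%N -> (f * g)%fps i = 1%fps i.
  move=> le_iM; rewrite (fps_mul_coefM fp (q := geom u M k)) // pgE //.
  by rewrite /fps_const; case: (i == 0%N).
have -> : (f^-1 * 1)%fps n = (f^-1 * (f * g))%fps n.
  apply: eq_bigr => i _; rewrite fg //.
  exact: leq_trans (leq_subr _ _) le_nM.
rewrite fps_mulA.
have -> : (f^-1 * f * g)%fps n = (g * 1)%fps n.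
  rewrite fps_mulC; apply: fps_mul_ext => // i.
  by rewrite fps_mulC fV // f0 oner_eq0.
by rewrite fps_mul1.
Qed.

Lemma Gpartial_coef u N M n : (n <= M)%N ->
  Gpartial u N n = (\prod_(j < N) geom u M (2 ^ j))`_n.
Proof.
elim: N n => [|N IHN] n le_nM.
  by rewrite big_ord0 coef1 /= /fps_const; case: (n == 0%N).
rewrite big_ord_recr /=; apply: (fps_mul_coefM _ _ le_nM) => k le_kM.
  exact: IHN.
by rewrite (fps_inv_geom_coef _ _ le_kM) ?expn_gt0.
Qed.

(** Telescoping: (1 - y)(1 + y) = 1 - y^2 with y = x^(2^N). *)
Lemma Gpartial_minus1 N :
  ((1 - fps_Xn (2 ^ N)) * Gpartial (-1) N =1 1 - 'X)%fps.
Proof.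
elim: N => [|N IHN]; first exact: fps_mul1.
have sq : (1 - fps_Xn (2 ^ N.+1) =1
           (1 - fps_Xn (2 ^ N)) * (1 - -1 *: fps_Xn (2 ^ N)))%fps.
  move=> n; pose p k : {poly rat} := 1 - 'X^k; pose q k : {poly rat} := 1 + 'X^k.
  have pE k i : (i <= n)%N -> (1 - fps_Xn k)%fps i = (p k)`_i.
    rewrite /fps_sub /fps_Xn /fps_const coefB coef1 coefXn.
    by case: (i == 0%N).
  have qE k i : (i <= n)%N -> (1 - -1 *: fps_Xn k)%fps i = (q k)`_i.
    rewrite /fps_sub /fps_scale /fps_Xn /fps_const coefD coef1 coefXn mulN1r opprK.
    by case: (i == 0%N).
  rewrite (fps_mul_coefM (pE _) (qE _)) // pE // /p /q -subr_sqr expr1n.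
  by rewrite -exprM -expnSr.
set f := (1 - fps_Xn (2 ^ N))%fps in IHN sq; set g := (1 - -1 *: _)%fps in sq.
have g0 : g 0%N != 0.
  rewrite /g /fps_sub /fps_scale /fps_Xn /fps_const.
  by rewrite (ltn_eqF (_ : 0 < 2 ^ N)%N) ?expn_gt0.
have fgV : (f * g * g^-1 =1 f)%fps.
  move=> k; rewrite -fps_mulA -[RHS]fps_mul1.
  exact: fps_mul_ext (frefl f) (fps_mulV g0) k.
move=> n; rewrite -IHN.
rewrite [LHS](fps_mul_ext sq (fps_mulC (Gpartial (-1) N) (g^-1)%fps)) fps_mulA.
exact: fps_mul_ext fgV (frefl _) n.
Qed.

(** The coefficient of x^n does not see the factor 1 - x^(2^(n+1)) of the previous
    lemma. *)
Lemma G_minus1 : (G (-1) =1 1 - 'X)%fps.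
Proof.
move=> n; rewrite /G -(Gpartial_minus1 n.+1).
have lt_n : (n < 2 ^ n.+1)%N by apply: ltn_trans (ltn_expl _ _).
rewrite fps_mulC -[LHS]fps_mul1; apply: eq_bigr => i _; congr (_ * _).
rewrite /fps_sub /fps_Xn ltn_eqF ?subr0 //.
exact: leq_ltn_trans (leq_subr _ _) lt_n.
Qed.

Definition weight n (a : multiplicities n) : nat := (\sum_(i < n) a i * i.+1)%N.

(** Expanding the product of geometric sums amounts to choosing a multiplicity for
    each part size. *)
Lemma prod_geomE u N (P : pred nat) :
  \prod_(i < N | P i.+1) geom u N i.+1 =
  \sum_(a : multiplicities N | parts_in a P) u ^+ nparts a *: 'X^(weight a).
Proof.
pose F (i : 'I_N) (k : 'I_N.+1) : {poly rat} :=
  if (0 < k)%N ==> P i.+1 then u ^+ k *: 'X^(k * i.+1) else 0.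
have sumF i : \sum_k F i k = if P i.+1 then geom u N i.+1 else 1.
  rewrite /F; case: ifP => Pi; last first.
    rewrite big_ord_recl /= expr0 mul0n scale1r big1 ?addr0 // => k _.
  by apply: eq_bigr => k _; rewrite implybT.
rewrite big_mkcond -(eq_bigr _ (fun i _ => sumF i)) bigA_distr_bigA /=.
rewrite [RHS]big_mkcond; apply: eq_bigr => a _.
case: ifP => [/forallP aP | /negbT].
  rewrite /nparts /weight -prodrXr -prodrXr -scaler_prod.
  by apply: eq_bigr => i _; rewrite /F aP.
case/forallPn=> i /negbTE not_aPi.
by rewrite (bigD1 i) //= /F not_aPi mul0r.
Qed.

(** Reindexes a product over the powers of 2 in 1, ..., N by the exponent; Q is a
    further condition on the parts. *)
Lemma prod_powers2 (F : nat -> {poly rat}) N (Q : pred nat) :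
  \prod_(i < N | is_pow 2 i.+1 && Q i.+1) F i.+1 =
  \prod_(j < N.+1 | (2 ^ j <= N)%N && Q (2 ^ j)%N) F (2 ^ j)%N.
Proof.
transitivity (\prod_(k <- [seq i.+1 | i <- iota 0 N] | is_pow 2 k && Q k) F k).
  rewrite -(big_mkord (fun k => is_pow 2 k.+1 && Q k.+1) (fun k => F k.+1)).
  by rewrite /index_iota subn0 big_map.
transitivity (\prod_(k <- [seq (2 ^ j)%N | j <- iota 0 N.+1]
                | (k <= N)%N && Q k) F k); last first.
  rewrite -(big_mkord (fun j => (2 ^ j <= N)%N && Q (2 ^ j)%N)
    (fun j => F (2 ^ j)%N)).
  by rewrite /index_iota subn0 big_map.
rewrite -big_filter -[RHS]big_filter; apply: perm_big; apply: uniq_perm.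
- by apply: filter_uniq; rewrite map_inj_uniq ?iota_uniq // => i j [].
- apply: filter_uniq; rewrite map_inj_uniq ?iota_uniq // => i j.
  exact: expnI.
move=> k; rewrite !mem_filter; case: (Q k); rewrite ?andbF ?andbT //.
apply/andP/andP => -[].
  case/existsP=> d /eqP def_k /mapP[i]; rewrite mem_iota add0n => /andP[_ lt_iN] eq_k.
  rewrite eq_k lt_iN -eq_k; split=> //; rewrite def_k; apply/map_f.
  rewrite mem_iota /= add0n ltnS; apply: ltnW; apply: leq_trans (ltn_ord d) _.
  by rewrite eq_k.
move=> le_kN /mapP[j _ def_k].
have lt_jk : (j < k)%N by rewrite def_k ltn_expl.
split; first by apply/existsP; exists (Ordinal lt_jk); apply/eqP.
have k0 : (0 < k)%N by apply: leq_ltn_trans lt_jk.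
by rewrite -(prednK k0); apply: map_f; rewrite mem_iota /= add0n prednK.
Qed.

Lemma coef_prod_low (I : finType) (P : pred I) (F F' : I -> {poly rat}) N :
  (forall i, P i -> forall k, (k <= N)%N -> (F i)`_k = (F' i)`_k) ->
  forall k, (k <= N)%N -> (\prod_(i | P i) F i)`_k = (\prod_(i | P i) F' i)`_k.
Proof.
move=> eqF; apply: (big_ind2 (fun p q => forall k, (k <= N)%N -> p`_k = q`_k)) => //.
move=> p p' q q' eq_p eq_q k le_kN; rewrite !coefM; apply: eq_bigr => i _.
rewrite eq_p ?eq_q //; first exact: leq_trans (leq_subr _ _) le_kN.
by apply: leq_trans le_kN; rewrite -ltnS.
Qed.

Lemma geom_low u N k i : (N < k)%N -> (i <= N)%N -> (geom u N k)`_i = (1 : {poly rat})`_i.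
Proof.
move=> lt_Nk le_iN; have lt_ik := leq_ltn_trans le_iN lt_Nk.
rewrite /geom big_ord_recl /= expr0 mul0n scale1r coefD coef_sum big1 ?addr0 // => j _.
rewrite coefZ coefXn ltn_eqF ?mulr0 //.
by apply: leq_trans lt_ik _; rewrite leq_pmull.
Qed.

(** The factors with 2 ^ j > N that are missing on the left have no terms of
    positive degree up to N. *)
Lemma prod_geom_coef u N (Q : pred nat) m : (m <= N)%N ->
  (\prod_(i < N | is_pow 2 i.+1 && Q i.+1) geom u N i.+1)`_m =
  (\prod_(j < N.+1 | Q (2 ^ j)%N) geom u N (2 ^ j))`_m.
Proof.
move=> le_mN; rewrite (prod_powers2 (geom u N)).
under eq_bigl do rewrite andbC; rewrite big_mkcondr /=.
apply: coef_prod_low le_mN => j _ k le_kN.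
by case: leqP => // lt_N2j; rewrite geom_low.
Qed.

Lemma partition_sum_coef u N P m :
  (\prod_(i < N | P i.+1) geom u N i.+1)`_m =
  \sum_(a : multiplicities N | (weight a == m) && parts_in a P) u ^+ nparts a.
Proof.
rewrite prod_geomE coef_sum big_mkcondl /= [LHS]big_mkcond [RHS]big_mkcond.
apply: eq_bigr => a _; case: ifP => // _; rewrite coefZ coefXn eq_sym.
by case: eqP; rewrite ?mulr1 ?mulr0.
Qed.

(** N only bounds the sizes and the multiplicities of the parts, so that any N >= m
    gives all partitions of m. *)
Lemma partition_gf u N m : (m <= N)%N ->
  \sum_(a : multiplicities N | (weight a == m) && parts_in a (is_pow 2))
     u ^+ nparts a = G u m.
Proof.
move=> le_mN; rewrite -partition_sum_coef.
rewrite (eq_bigl (fun i : 'I_N => is_pow 2 i.+1 && predT i.+1)) => [|i]; last first.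
  by rewrite andbT.
by rewrite prod_geom_coef //= -Gpartial_coef // G_limit.
Qed.

(** The parts allowed here are the doubles of the powers of 2, so the product over
    them is obtained by substituting x^2 for x. *)
Lemma even_partition_gf N : (0 < N)%N ->
  \sum_(a : multiplicities N | (weight a == N) &&
     parts_in a (fun k => is_pow 2 k && ~~ odd k)) 1 = fps_comp_Xn (G 1) 2 N.
Proof.
move=> N0; under eq_bigr => a _ do rewrite -(expr1n _ (nparts a)).
rewrite -partition_sum_coef (prod_geom_coef _ (fun k => ~~ odd k)) //.
rewrite big_mkcond big_ord_recl /= mul1r.
transitivity (((\prod_(j < N) geom 1 N (2 ^ j)) \Po 'X^2)`_N).
  apply: (congr1 (fun p : {poly rat} => p`_N)).
  rewrite rmorph_prod; apply: eq_bigr => j _ /=.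
  rewrite oddX /= /geom rmorph_sum; apply: eq_bigr => k _ /=.
  by rewrite comp_polyZ rmorphXn /= comp_polyX -exprM mulnCA -expnS.
rewrite coef_comp_poly_Xn // /fps_comp_Xn; case: ifP => // _.
by rewrite -Gpartial_coef ?leq_div // G_limit // ltn_Pdiv.
Qed.

End GeneratingFunctions.

(** * The counting formulas *)

Section Counting.
Import GRing.Theory Num.Theory.

Definition even_ppow_partitions p n : {set multiplicities n} :=
  [set a in ppow_partitions p n | parts_in a (fun k => ~~ odd k)].

Definition D_types p n : {set multiplicities n * multiplicities n} :=
  [set ab | p_type p ab.1 ab.2 && D_type ab.1 ab.2].

Lemma D_type_no_cycles n (a : multiplicities n) :
  D_type a (no_cycles n) = is_partition a.
Proof.
rewrite /D_type /is_partition.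
have -> : nparts (no_cycles n) = 0%N by apply: big1 => i _; rewrite ffunE.
rewrite /= andbT (eq_bigr (fun i => a i * i.+1)%N) // => i _.
by rewrite [no_cycles n i]ffunE addn0.
Qed.

Lemma p_type_no_cycles p n (a : multiplicities n) : prime p ->
  p_type p a (no_cycles n) = parts_in a (is_pow p).
Proof. by move=> p_pr; rewrite /p_type parts_in_no_cycles andbT parts_in_pow. Qed.

(** Each pair of partitions contributes one class, and a second one if it is a
    splitting type; the latter have no negative cycles. *)
Lemma rt_WD p n : prime p -> (0 < n)%N ->
  rt p (WD n) = (#|D_types p n| + #|even_ppow_partitions p n|)%N.
Proof.
move=> p_pr n0.
pose type (x : {perm svec n}) := (cycle_mult x false, cycle_mult x true).
pose Q (ab : multiplicities n * multiplicities n) := p_type p ab.1 ab.2.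
rewrite (@p_classes_by_type _ _ _ _ type Q) //; last first.
  by move=> x /(subsetP (WD_WB n))/WBP sx; rewrite (p_elt_type p sx).
rewrite (eq_bigr (fun ab => D_type ab.1 ab.2 +
    D_type ab.1 ab.2 * splitting_type ab.1 ab.2)%N) => [|[a b] _]; last first.
  by rewrite card_WD_classes_of_type // mulnS.
rewrite big_split /=; congr (_ + _)%N.
  rewrite -sum1_card big_mkcond [RHS]big_mkcond; apply: eq_bigr => ab _.
  by rewrite inE /Q; case: (p_type _ _ _) => //=; case: (D_type _ _).
pose f (a : multiplicities n) := (a, no_cycles n).
have f_inj : injective f by move=> a a' [].
rewrite -(card_imset _ f_inj) -sum1_card big_mkcond [RHS]big_mkcond.
apply: eq_bigr => -[a b] _; rewrite mulnb /Q /=.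
case: imsetP => [[a' a'P [-> ->]] | not_im].
  move: a'P; rewrite !inE => /andP[/andP[part_a pow_a] even_a].
  rewrite p_type_no_cycles // pow_a D_type_no_cycles part_a /splitting_type.
  by rewrite even_a (introT (no_cyclesP _)).
case: ifP => // pt; case: andP => // -[Dab /andP[/no_cyclesP b0 even_a]].
case: not_im; exists a; last by rewrite b0.
rewrite b0 p_type_no_cycles // in pt; rewrite b0 D_type_no_cycles in Dab.
by rewrite !inE Dab pt even_a.
Qed.

(** A nonempty partition into powers of p has an odd part. *)
Lemma even_ppow_partitions_odd p n : prime p -> p <> 2 -> (0 < n)%N ->
  even_ppow_partitions p n = set0.
Proof.
move=> p_pr p2 n0; apply/setP=> a; rewrite !inE; apply/negP.
case/andP=> /andP[/eqP part_a pow_a] even_a.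
move: n0; rewrite -part_a; apply/negP; rewrite -eqn0Ngt; apply/eqP.
apply: big1 => i _; have [-> //|] := posnP (a i).
move=> ai0; have := implyP (forallP even_a i) ai0.
case/existsP: (implyP (forallP pow_a i) ai0) => d /eqP ->.
by rewrite oddX; case: (even_prime p_pr) => // ->; rewrite orbT.
Qed.

(** For odd p, twice the length of a negative cycle is never a power of p. *)
Lemma D_types_odd p n : prime p -> p <> 2 -> #|D_types p n| = rt p (Sn n).
Proof.
move=> p_pr p2; rewrite rt_Sn //.
pose f (a : multiplicities n) := (a, no_cycles n).
have f_inj : injective f by move=> a a' [].
rewrite -(card_imset _ f_inj); apply: eq_card => -[a b].
apply/idP/imsetP => [|[a' a'P [-> ->]]]; rewrite !inE; last first.
  rewrite p_type_no_cycles // D_type_no_cycles andbC.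
  by move: a'P; rewrite inE.
case/andP=> /= pt Dab.
have b0 : b = no_cycles n.
  apply/no_cyclesP/forallP => i; rewrite -val_eqE /= -leqn0 leqNgt.
  apply/negP => bi0; have /andP[_ /forallP/(_ i)] := pt; rewrite bi0 /=.
  rewrite pnatM => /andP[_]; rewrite pnatE // inE => /eqP.
  by move=> eq_p; case: p2.
exists a; last by rewrite b0.
move: pt Dab; rewrite b0 p_type_no_cycles // D_type_no_cycles inE.
by move=> -> ->.
Qed.

Lemma rt_trivial (gT : finGroupType) (H : {group gT}) p :
  (forall x : gT, x = 1%g) -> rt p H = 1%N.
Proof.
move=> x1; rewrite /rt /r eq_card0 // => C; rewrite inE.
apply/andP => -[/repr_classesP[_ ->] /forallP all_p].
have := all_p (repr C); rewrite class_refl /= (x1 (repr C)) /has_ppow_order.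
case/existsP=> d /andP[d0 _].
by have := ltn_ord d; rewrite [X in (_ < X)%N]order1 ltnNge d0.
Qed.

Lemma rt_WD0 p : rt p (WD 0) = 1%N.
Proof. by apply: rt_trivial => x; apply/permP => -[[]]. Qed.

Lemma rt_Sn0 p : rt p (Sn 0) = 1%N.
Proof. by apply: rt_trivial => x; apply/permP => -[]. Qed.

Local Open Scope ring_scope.

Lemma card_weight_partitions N m : (m <= N)%N ->
  (#|[set a : multiplicities N | (weight a == m) && parts_in a (is_pow 2)]|%:R
    = G 1 m :> rat).
Proof.
move=> le_mN; rewrite -(partition_gf 1 le_mN) -sum1dep_card natr_sum.
by apply: eq_bigr => a _; rewrite expr1n.
Qed.

(** The mean of 1 and (-1)^k is 1 for even k and 0 for odd k. *)
Lemma card_even_weight_partitions N m : (m <= N)%N ->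
  (#|[set a : multiplicities N |
       (weight a == m) && parts_in a (is_pow 2) && ~~ odd (nparts a)]|%:R
    = (1 / 2 *: (G 1 + G (-1)))%fps m :> rat).
Proof.
move=> le_mN; rewrite /fps_scale /fps_add.
rewrite -(partition_gf 1 le_mN) -(partition_gf (-1) le_mN) -big_split mulr_sumr /=.
rewrite -sum1dep_card natr_sum big_mkcondr /=.
apply: eq_bigr => a _; rewrite expr1n -signr_odd.
by case: (odd _); rewrite ?expr0 ?expr1 /=; lra.
Qed.

Lemma rt_Sn2 n : (rt 2 (Sn n))%:R = G 1 n.
Proof. by rewrite rt_Sn // -(card_weight_partitions (leqnn n)). Qed.

Lemma rt_even_parts2 n :
  (rt_even_parts 2 n)%:R = (1 / 2 *: (G 1 + G (-1)))%fps n.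
Proof.
rewrite -(card_even_weight_partitions (leqnn n)) /rt_even_parts; congr (_%:R).
by apply: eq_card => a; rewrite !inE.
Qed.

Lemma rt_even_lengths2 n : (0 < n)%N ->
  (rt_even_lengths 2 n)%:R = fps_comp_Xn (G 1) 2 n.
Proof.
move=> n0; rewrite -even_partition_gf // /rt_even_lengths /=.
rewrite -sum1_card natr_sum; apply: eq_bigl => a; rewrite !inE -andbA.
congr (_ && _); apply/andP/forallP => [[/forallP pow /forallP ev] i | H].
  by apply/implyP=> ai; rewrite (implyP (pow i)) // (implyP (ev i)).
by split; apply/forallP=> i; apply/implyP=> ai;
  have /andP[] := implyP (H i) ai.
Qed.

(** Splitting by the total length m of the positive cycles. *)
Lemma D_types2 n :
  #|D_types 2 n| = (\sum_(m < n.+1) rt 2 (Sn m) * rt_even_parts 2 (n - m))%N.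
Proof.
have D_typeE (a b : multiplicities n) :
    D_type a b = (weight a + weight b == n)%N && ~~ odd (nparts b).
  rewrite /D_type /weight -big_split; congr ((_ == _) && _).
  by apply: eq_bigr => i _; rewrite mulnDl.
have p_typeE (a b : multiplicities n) :
    p_type 2 a b = parts_in a (is_pow 2) && parts_in b (is_pow 2).
  rewrite /p_type parts_in_pow //; congr (_ && _); rewrite -[RHS]parts_in_pow //.
  by apply: eq_forallb => i; rewrite pnatM andbT.
rewrite -sum1_card.
rewrite (partition_big (fun ab => inord (weight ab.1) : 'I_n.+1) xpredT) //=.
apply: eq_bigr => m _; have le_mn : (m <= n)%N by rewrite -ltnS.
have rtE : rt 2 (Sn m) = #|[set a : multiplicities n |
    (weight a == m) && parts_in a (is_pow 2)]|.
  by apply/eqP; rewrite -(eqr_nat rat) rt_Sn2 card_weight_partitions.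
have evE : rt_even_parts 2 (n - m) = #|[set a : multiplicities n |
    (weight a == n - m)%N && parts_in a (is_pow 2) && ~~ odd (nparts a)]|.
  apply/eqP; rewrite -(eqr_nat rat) rt_even_parts2.
  by rewrite card_even_weight_partitions // leq_subr.
rewrite rtE evE -cardsX -sum1_card; apply: eq_bigl => -[a b].
rewrite !inE /= p_typeE D_typeE.
have [le_an | lt_na] := leqP (weight a) n.
  rewrite -val_eqE /= inordK ?ltnS //.
  case: (weight a =P m) => [-> | _]; rewrite ?andbF //= andbT.
  rewrite -[weight b == _](eqn_add2l m) subnKC //.
  by case: (parts_in a _); case: (parts_in b _); rewrite //= ?andbT ?andbF.
rewrite (gtn_eqF (leq_trans lt_na (leq_addr _ _))) !andbF.
by rewrite (gtn_eqF (leq_ltn_trans le_mn lt_na)).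
Qed.

Lemma OGFt_A2 : OGFt_A 2 =1 G 1.
Proof. by move=> n; exact: rt_Sn2. Qed.

Lemma OGFt_A2_mul_even : (OGFt_A 2 * (1 / 2 *: (G 1 + G (-1))) =1
  ogf (fun n => \sum_(m < n.+1) rt 2 (Sn m) * rt_even_parts 2 (n - m))%N)%fps.
Proof.
move=> n; rewrite /ogf natr_sum; apply: eq_bigr => m _.
by rewrite natrM rt_even_parts2.
Qed.

Lemma OGFt_D2 : (OGFt_D 2 =1
  OGFt_A 2 * (1 / 2 *: (G 1 + G (-1))) + fps_comp_Xn (OGFt_A 2) 2 - 1)%fps.
Proof.
move=> n; rewrite /fps_sub [X in X - _]/fps_add OGFt_A2_mul_even /ogf.
have -> : fps_comp_Xn (OGFt_A 2) 2 n = fps_comp_Xn (G 1) 2 n.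
  by rewrite /fps_comp_Xn; case: ifP; rewrite ?OGFt_A2.
have [-> | n0] := posnP n; last first.
  rewrite /OGFt_D /ogf rt_WD // natrD D_types2 /fps_const gtn_eqF // subr0.
  by rewrite -rt_even_lengths2.
have G0 : G 1 0 = 1 by rewrite -rt_Sn2 rt_Sn0.
have ev0 : (rt_even_parts 2 0)%:R = 1 :> rat.
  rewrite rt_even_parts2 /fps_scale /fps_add G0 G_minus1.
  by rewrite /fps_sub /fps_const /fps_Xn /=; lra.
rewrite /OGFt_D /ogf rt_WD0 big_ord1 rt_Sn0 mul1n ev0 /fps_comp_Xn div0n G0.
by rewrite /fps_const addrK.
Qed.

(** This is G(x,1) = OGFt_A 2 and G(x,-1) = 1 - x, distributed over the sum. *)
Lemma OGFt_A2_square : (OGFt_A 2 * (1 / 2 *: (G 1 + G (-1))) =1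
  1 / 2 *: (OGFt_A 2 * OGFt_A 2) + 1 / 2 *: (OGFt_A 2 * (1 - 'X)))%fps.
Proof.
move=> n; rewrite /fps_add /fps_scale /fps_mul !mulr_sumr -big_split /=.
by apply: eq_bigr => i _; rewrite G_minus1 -OGFt_A2; ring.
Qed.

End Counting.

Theorem theorem4p6 :
  (forall n : nat, (0 < n)%N ->
     rt 2 (WD n) =
       (\sum_(m < n.+1) rt 2 (Sn m) * rt_even_parts 2 (n - m)
        + rt_even_lengths 2 n)%N)
  /\
  (forall p n : nat, prime p -> p <> 2 ->
     rt p (WD n) = (rt p (Sn n) + rt_even_lengths p n)%N)
  /\
  (* The term - 1 is needed only in degree 0: the
     group W_{D_0} is trivial, so the left-hand side has constant term 1. *)
  ((OGFt_D 2 =1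
      OGFt_A 2 * (1 / 2 *: (G 1%R + G (-1)%R)) + fps_comp_Xn (OGFt_A 2) 2
      - 1)%fps
   /\
   (OGFt_A 2 * (1 / 2 *: (G 1%R + G (-1)%R)) + fps_comp_Xn (OGFt_A 2) 2 =1
      1 / 2 *: (OGFt_A 2 * OGFt_A 2) + 1 / 2 *: (OGFt_A 2 * (1 - 'X))
      + fps_comp_Xn (OGFt_A 2) 2)%fps)
  /\
  (forall p : nat, prime p -> p <> 2 ->
     OGFt_D p =1 OGFt_A p /\ OGF_D p =1 OGF_A p).
Proof.
have part2 n : (0 < n)%N -> rt 2 (WD n) =
       (\sum_(m < n.+1) rt 2 (Sn m) * rt_even_parts 2 (n - m)
        + rt_even_lengths 2 n)%N.
  by move=> n0; rewrite rt_WD // D_types2.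
have part_odd p n : prime p -> p <> 2 -> rt p (WD n) = rt p (Sn n).
  move=> p_pr p2; have [-> | n0] := posnP n.
    by rewrite rt_WD0 rt_Sn0.
  by rewrite rt_WD // D_types_odd // even_ppow_partitions_odd // cards0 addn0.
have even_odd p n : prime p -> p <> 2 -> rt_even_lengths p n = 0%N.
  move=> p_pr p2; rewrite /rt_even_lengths; case: eqP => //= _.
  by case: posnP => // n0; apply/eqP; rewrite cards_eq0;
    apply/eqP/even_ppow_partitions_odd.
split=> //; split; first by move=> p n p_pr p2; rewrite part_odd // even_odd // addn0.
split; last first.
  move=> p p_pr p2; split=> n; first by rewrite /OGFt_D /OGFt_A /ogf part_odd.
  rewrite /OGF_D /OGF_A /ogf; congr (_%:R)%R.
  by have := part_odd p n p_pr p2; rewrite /rt !addn1 => -[].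
split; first exact: OGFt_D2.
by move=> n; congr (_ + _)%R; exact: OGFt_A2_square.
Qed.
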